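(* Let $X,T>0$, $D=(0,T]\times(0,X]\times(0,1)$, and let $w$ be an Oleinik monotone solution of the Crocco problem in $D$ satisfying the data conditions with parameters $(c_0,\mu,\alpha_0,C_1,\beta)$, with associated constants $b,K,\delta$. Assume that for some $T_1\in(0,T]$, $$w\ge b(1-\eta)\quad\text{in }[0,T_1]\times[0,X]\times[0,1].$$ Then, in $[0,T_1]\times[0,X]\times[0,1]$, $$w\,\partial_\eta^2w\le2\delta,$$ $$-C_1(1-\eta)^{\alpha_0}\le\partial_\xi w+\partial_\tau w\le\frac\delta2w,\qquad -C_1(1-\eta)^{\alpha_0}\le\partial_\tau w\le b\delta(1-\eta)^{\alpha_0}.$$
   Context: Crocco problem in $D=(0,T]\times(0,X]\times(0,1)$ (variables $(\tau,\xi,\eta)$): $-\partial_\tau w-\eta\,\partial_\xi w+w^2\partial_\eta^2w=0$ in $D$; $w\,\partial_\eta w|_{\eta=0}=0$, $w|_{\eta=1}=0$; $w|_{\tau=0}=w_0(\xi,\eta)$, $w|_{\xi=0}=w_1(\tau,\eta)$. An Oleinik monotone solution is a (global in $\tau$) solution $w\in C^2([0,+\infty)\times[0,X]\times[0,1))\cap C^3((0,+\infty)\times(0,X]\times(0,1))$ of this problem such that $\lim_{\eta\to1}\partial_\xi w=\lim_{\eta\to1}\partial_\tau w=0$ and $\lim_{\eta\to1}w\,\partial_\eta^2w=l(\tau,\xi)$ for some continuous $l$. Here $w,\partial_\xi w,\partial_\tau w$ are understood to extend continuously to $\eta=1$ with value $0$, and $w\partial_\eta^2w$ to extend continuously with value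 $l$; these are their values at $\eta=1$. Data conditions with parameters $(c_0,\mu,\alpha_0,C_1,\beta)$, where $c_0\in(0,1)$, $\mu\in(0,\frac1{100})$, $\alpha_0\in(0,1)$, $C_1>0$ and $\beta>0$ is a constant depending only on $\mu,c_0,X$ (independent of $T$): set $b=\frac{c_0}{4}e^{-\beta X}e^{-8/3}$, $K=e^X\max\{2,2C_1^{\frac1{\alpha_0}-1}\}$, $\delta=\min\{\frac1{10}\min_{\alpha\in[\alpha_0/2,\alpha_0]}\alpha(1-\alpha)b^2,\ \frac1{321e^X},\ \frac{\min\{1,C_1\}}{b2^{\alpha_0}}\}$. The conditions are: $c_0(1-\eta)\le w_i\le c_0^{-1}(1-\eta)\sqrt{-\ln(\mu(1-\eta))}$ for $i=0,1$; and, both on $\{\xi=0\}$ and on $\{\tau=0\}$, $-C_1(1-\eta)^{\alpha_0}\le\partial_\xi w+\partial_\tau w\le\frac{(\delta b)^{1/\alpha_0}}{K}(1-\eta)$ and $-C_1(1-\eta)^{\alpha_0}\le\partial_\tau w\le b\delta(1-\eta)^{\alpha_0}$. *)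

(* Defs.v *)
From HB Require Import structures.
From mathcomp Require Import all_boot all_order all_algebra.
From mathcomp Require Import all_classical all_reals all_analysis.

Set Implicit Arguments.
Unset Strict Implicit.
Unset Printing Implicit Defensive.

Import Order.TTheory GRing.Theory Num.Theory.
Import numFieldNormedType.Exports.

Local Open Scope classical_set_scope.
Local Open Scope ring_scope.

(* A point is a triple (tau, xi, eta), with eta = p.2 and (tau, xi) = p.1. *)

Definition dir_tau {R : realType} : R * R * R := (1, 0, 0).
Definition dir_xi {R : realType} : R * R * R := (0, 1, 0).
Definition dir_eta {R : realType} : R * R * R := (0, 0, 1).

(* Difference quotients are restricted to increments that stay in S, so the
   derivative is one-sided at boundary points belonging to S.  When S contains
   a neighbourhood of p this is 'D_v f p. *)
Definition diff_quot {R : realType} (f : R * R * R -> R) (v p : R * R * R) :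
  R -> R := fun h => h^-1 * (f (p + h *: v) - f p).

Definition increments {R : realType} (S : set (R * R * R)) (v p : R * R * R) :
  set_system R := within [set h | S (p + h *: v)] (0 : R)^'.

Definition derivable_on {R : realType} (S : set (R * R * R))
    (f : R * R * R -> R) (v p : R * R * R) : Prop :=
  cvg (diff_quot f v p @ increments S v p).

Definition deriv_on {R : realType} (S : set (R * R * R)) (v : R * R * R)
    (f : R * R * R -> R) : R * R * R -> R :=
  fun p => lim (diff_quot f v p @ increments S v p).

(* f is of class C^k on S, up to the part of the boundary included in S. *)
Fixpoint class_C {R : realType} (S : set (R * R * R)) (k : nat)
    (f : R * R * R -> R) : Prop :=
  {within S, continuous f} /\
  if k is k'.+1 then
    forall v, [\/ v = dir_tau, v = dir_xi | v = dir_eta] ->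
      (forall p, S p -> derivable_on S f v p) /\
      class_C S k' (deriv_on S v f)
  else True.

Definition dom {R : realType} (X : R) : set (R * R * R) :=
  `[0, +oo[ `*` `[0, X] `*` `[0, 1[.

Definition dom_interior {R : realType} (X : R) : set (R * R * R) :=
  `]0, +oo[ `*` `]0, X] `*` `]0, 1[.

Definition dom_closed {R : realType} (X : R) : set (R * R * R) :=
  `[0, +oo[ `*` `[0, X] `*` `[0, 1].

(* f with its values on the face eta = 1 replaced by v (tau, xi). *)
Definition ext_face {R : realType} (v : R * R -> R) (f : R * R * R -> R) :
  R * R * R -> R := fun p => if p.2 == 1 then v p.1 else f p.

(* The functions below include their prescribed values at eta = 1. *)
Definition w_tau {R : realType} (X : R) (w : R * R * R -> R) :=
  ext_face (fun _ => 0) (deriv_on (dom X) dir_tau w).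

Definition w_xi {R : realType} (X : R) (w : R * R * R -> R) :=
  ext_face (fun _ => 0) (deriv_on (dom X) dir_xi w).

Definition w_w_eta_eta {R : realType} (X : R) (l : R * R -> R)
    (w : R * R * R -> R) :=
  ext_face l (fun p =>
    w p * deriv_on (dom X) dir_eta (deriv_on (dom X) dir_eta w) p).

Record crocco_problem {R : realType} (T X : R) (w0 w1 : R * R -> R)
    (w : R * R * R -> R) : Prop := CroccoProblem {
  crocco_eq : forall tau xi eta : R,
    0 < tau <= T -> 0 < xi <= X -> 0 < eta < 1 ->
    - deriv_on (dom X) dir_tau w (tau, xi, eta)
    - eta * deriv_on (dom X) dir_xi w (tau, xi, eta)
    + w (tau, xi, eta) ^+ 2
      * deriv_on (dom X) dir_eta (deriv_on (dom X) dir_eta w) (tau, xi, eta)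
    = 0;
  crocco_eta0 : forall tau xi : R, 0 <= tau <= T -> 0 <= xi <= X ->
    w (tau, xi, 0) * deriv_on (dom X) dir_eta w (tau, xi, 0) = 0;
  crocco_eta1 : forall tau xi : R, 0 <= tau <= T -> 0 <= xi <= X ->
    w (tau, xi, 1) = 0;
  crocco_tau0 : forall xi eta : R, 0 <= xi <= X -> 0 <= eta <= 1 ->
    w (0, xi, eta) = w0 (xi, eta);
  crocco_xi0 : forall tau eta : R, 0 <= tau <= T -> 0 <= eta <= 1 ->
    w (tau, 0, eta) = w1 (tau, eta)
}.

(* l is the limit of w * d_eta^2 w at eta = 1. *)
Record oleinik_monotone_solution {R : realType} (T X : R)
    (w0 w1 l : R * R -> R) (w : R * R * R -> R) : Prop :=
  OleinikMonotoneSolution {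
  oleinik_crocco : crocco_problem T X w0 w1 w;
  oleinik_C2 : class_C (dom X) 2 w;
  oleinik_C3 : class_C (dom_interior X) 3 w;
  oleinik_w_eta1 : forall tau xi : R, 0 <= tau -> 0 <= xi <= X ->
    w (tau, xi, 1) = 0;
  oleinik_w_cont : {within dom_closed X, continuous w};
  oleinik_w_xi_cont : {within dom_closed X, continuous (w_xi X w)};
  oleinik_w_tau_cont : {within dom_closed X, continuous (w_tau X w)};
  oleinik_l_cont : {within `[0, +oo[ `*` `[0, X], continuous l};
  oleinik_w_w_eta_eta_cont :
    {within dom_closed X, continuous (w_w_eta_eta X l w)}
}.

Definition const_b {R : realType} (X c0 beta : R) : R :=
  c0 / 4 * expR (- beta * X) * expR (- (8 / 3)).

Definition const_K {R : realType} (X alpha0 C1 : R) : R :=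
  expR X * Num.max 2 (2 * C1 `^ (alpha0^-1 - 1)).

Definition const_delta {R : realType} (X alpha0 C1 b : R) : R :=
  Num.min
    (10^-1 * inf [set alpha * (1 - alpha) * b ^+ 2
                 | alpha in `[alpha0 / 2, alpha0]])
    (Num.min (321 * expR X)^-1 (Num.min 1 C1 / (b * 2 `^ alpha0))).

(* At eta = 1 the library value ln 0 = 0 is harmless: the factor 1 - eta
   gives the upper bound its limit value 0. *)
Definition profile_bounds {R : realType} (c0 mu eta z : R) : Prop :=
  c0 * (1 - eta) <= z
    <= c0^-1 * (1 - eta) * Num.sqrt (- ln (mu * (1 - eta))).

Definition derivative_bounds {R : realType} (X alpha0 C1 b K delta : R)
    (w : R * R * R -> R) (p : R * R * R) : Prop :=
  - C1 * (1 - p.2) `^ alpha0 <= w_xi X w p + w_tau X w p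
    <= (delta * b) `^ alpha0^-1 / K * (1 - p.2) /\
  - C1 * (1 - p.2) `^ alpha0 <= w_tau X w p
    <= b * delta * (1 - p.2) `^ alpha0.

Record data_conditions {R : realType} (T X c0 mu alpha0 C1 beta : R)
    (w0 w1 : R * R -> R) (w : R * R * R -> R) : Prop := DataConditions {
  data_c0 : 0 < c0 < 1;
  data_mu : 0 < mu < 100^-1;
  data_alpha0 : 0 < alpha0 < 1;
  data_C1 : 0 < C1;
  data_beta : 0 < beta;
  data_w0 : forall xi eta : R, 0 <= xi <= X -> 0 <= eta <= 1 ->
    profile_bounds c0 mu eta (w0 (xi, eta));
  data_w1 : forall tau eta : R, 0 <= tau <= T -> 0 <= eta <= 1 ->
    profile_bounds c0 mu eta (w1 (tau, eta));
  data_xi0 : forall tau eta : R, 0 <= tau <= T -> 0 <= eta <= 1 ->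
    let b := const_b X c0 beta in
    derivative_bounds X alpha0 C1 b (const_K X alpha0 C1)
      (const_delta X alpha0 C1 b) w (tau, 0, eta);
  data_tau0 : forall xi eta : R, 0 <= xi <= X -> 0 <= eta <= 1 ->
    let b := const_b X c0 beta in
    derivative_bounds X alpha0 C1 b (const_K X alpha0 C1)
      (const_delta X alpha0 C1 b) w (0, xi, eta)
}.

(* Main.v *)
Require Import Defs.
From mathcomp Require Import all_boot all_order all_algebra.
From mathcomp Require Import all_classical all_reals all_analysis.
From mathcomp Require Import ring lra.
Import Order.TTheory GRing.Theory Num.Theory.
Import numFieldNormedType.Exports.
Local Open Scope classical_set_scope.
Local Open Scope ring_scope.

Set Implicit Arguments.
Unset Strict Implicit.
Unset Printing Implicit Defensive.

(** Write f = w_tau, g = w_xi + w_tau and M = w w_etaeta.  Differentiating the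
    Crocco equation along tau and along xi shows that f and g both solve

      z_tau + eta z_xi - w^2 z_etaeta = 2 M z   (crocco_linearized),

    and since w > 0 forces w_eta = 0 on the face eta = 0, both have zero
    eta-derivative there (neumann_derivative).  As long as M <= 2 delta, the
    maximum principle (comparison) keeps a solution of this equation below any
    strict supersolution that is above it for tau = 0, xi = 0 and eta = 1, and
    whose eta-derivative at eta = 0 is negative (linearized_le).  Two families
    of supersolutions are enough.

    - C (1 - eta)^alpha0: its concavity produces
      C alpha0 (1 - alpha0) w^2 (1 - eta)^(alpha0 - 2), which beats 2 M times
      the function because w >= b (1 - eta) and
      10 delta <= alpha0 (1 - alpha0) b^2 (power_supersolution).  It bounds f
      on both sides and g from below.
    - A e^xi ((1 - eta) + m (1 - eta^2)) with m = 3 delta / b^2: the factor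
      e^xi produces eta times the function, enough for eta >= 4 delta, and the
      quadratic correction takes over near eta = 0, where the transport term
      degenerates (transport_supersolution).  It starts above the data
      A (1 - eta) of g and stays below (delta b / 2)(1 - eta) <= (delta / 2) w
      (transport_amplitude): with A = (delta b)^(1/alpha0) / K there is
      enough room, because delta <= alpha0 (1 - alpha0) b^2 / 10 makes
      the loss 1 + 2 m smaller than the gain (delta b)^(1 - 1/alpha0).

    The hypothesis M <= 2 delta is then recovered by continuity in tau.  The
    equation reads (1 - eta) f + eta g = w M (crocco_identity), so the upper
    bounds on f and g imply M <= 3 delta / 2 < 2 delta.  At the least time at
    which M reaches 2 delta, which exists by compactness if there is any, this
    is a contradiction (w_w_eta_eta_lt).

    The derivatives in the definitions are one-sided on the boundary.  Apart from
    the slope at eta = 0, derivatives are only taken at points with tau > 0,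
    0 < xi < X and 0 < eta < 1, where they are ordinary directional derivatives,
    and the estimates are extended to the closed domain by continuity
    (le0_closure). *)

(** * Directional derivatives *)

Section DirectionalCalculus.
Context {R : realType} {V : normedModType R}.
Implicit Types (F : V -> R) (p v : V).

Lemma is_derive_cvg F p v d :
  is_derive p v F d -> h^-1 * (F (p + h *: v) - F p) @[h --> 0^'] --> d.
Proof.
move=> [dF <-].
apply: (cvg_trans _ dF).
apply: near_eq_cvg; near=> h => /=.
by rewrite /shift/= /GRing.scale/= [h *: v + p]addrC.
Unshelve. all: by end_near. Qed.

Lemma is_derive_line F p v s d :
  is_derive (p + s *: v) v F d -> is_derive s 1 (fun r : R => F (p + r *: v)) d.
Proof.
move=> dF; have cF : (fun h : R => h^-1 *: (((fun r : R => F (p + r *: v)) \o shift s) (h *: 1)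
     - F (p + s *: v))) @ 0^' --> d.
  apply: (cvg_trans _ (is_derive_cvg dF)); apply: near_eq_cvg; near=> h.
  by rewrite /shift /= [h%:A]mulr1 scalerDl [h *: v + _]addrC addrA.
by split; [apply/cvg_ex; exists d | exact/cvg_lim].
Unshelve. all: by end_near. Qed.

(** Only negative increments are constrained: a maximum over a box may lie on a
    face tau = t or xi = x, with no information on its far side. *)
Lemma derive_ge0_of_left_max F p v d : is_derive p v F d ->
  (\forall h \near (0:R)^'-, F (p + h *: v) <= F p) -> 0 <= d.
Proof.
move=> /is_derive_cvg dF mF.
have dF' : h^-1 * (F (p + h *: v) - F p) @[h --> 0^'-] --> d.
  by exact: cvg_dnbhs_at_left dF.
apply: (cvgr_to_ge dF'); near=> h.
by rewrite mulr_le0 ?invr_le0 ?subr_le0//; near: h => //; exact: nbhs_left_le.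
Unshelve. all: by end_near. Qed.

Lemma derive_le0_of_right_max F p v d : is_derive p v F d ->
  (\forall h \near (0:R)^'+, F (p + h *: v) <= F p) -> d <= 0.
Proof.
move=> /is_derive_cvg dF mF.
have dF' : h^-1 * (F (p + h *: v) - F p) @[h --> 0^'+] --> d.
  by exact: cvg_dnbhs_at_right dF.
apply: (cvgr_to_le dF'); near=> h.
by rewrite mulr_ge0_le0 ?invr_ge0 ?subr_le0//; near: h => //; exact: nbhs_right_ge.
Unshelve. all: by end_near. Qed.

Lemma near_right_ex (P : set R) :
  (\forall h \near (0:R)^'+, P h) -> exists2 e : R, 0 < e & forall h, 0 < h <= e -> P h.
Proof.
move=> [e /= e0 He]; exists (e / 2); first by rewrite divr_gt0.
move=> h /andP[h0 he]; apply: He => //=; rewrite sub0r normrN gtr0_norm//.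
by apply: (le_lt_trans he); rewrite ltr_pdivrMr// ltr_pMr// ltrDl.
Qed.

Lemma is_derive_cvgP F p v d :
  h^-1 * (F (p + h *: v) - F p) @[h --> 0^'] --> d -> is_derive p v F d.
Proof.
move=> cF; have cF' :
  (fun h => h^-1 *: ((F \o shift p) (h *: v) - F p)) @ 0^' --> d.
  apply: (cvg_trans _ cF); apply: near_eq_cvg; near=> h => /=.
  by rewrite /shift/= /GRing.scale/= [h *: v + p]addrC.
by split; [apply/cvg_ex; exists d | exact/cvg_lim].
Unshelve. all: by end_near. Qed.

Lemma is_derive_translate F p v a d :
  is_derive (p + a) v F d -> is_derive p v (fun q => F (q + a)) d.
Proof.
move=> /is_derive_cvg dF; apply: is_derive_cvgP.
by apply: (cvg_trans _ dF); apply: near_eq_cvg; near=> h; rewrite addrAC.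
Unshelve. all: by end_near. Qed.

Lemma mvt_line F (G : V -> R) p v (e : R) : 0 < e ->
  (forall s, 0 <= s <= e -> is_derive (p + s *: v) v F (G (p + s *: v))) ->
  exists2 c, 0 < c < e & F (p + e *: v) - F p = G (p + c *: v) * e.
Proof.
move=> e0 dF; pose y (h : R) := F (p + h *: v).
have dy x : 0 <= x <= e -> is_derive x 1 y (G (p + x *: v)).
  by move=> xe; apply: is_derive_line; exact: dF.
have [||c] := @MVT R y (fun h => G (p + h *: v)) 0 e e0.
- by move=> x; rewrite in_itv/= => /andP[x0 xe]; apply: dy; rewrite !ltW.
- by apply: derivable_within_continuous => x; rewrite in_itv/= => /dy[].
- by rewrite in_itv/= => ce; rewrite /y scale0r addr0 subr0 => E; exists c.
Qed.

(** G is the derivative of F near p.  It vanishes at p, so d > 0 would make it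
    positive just after p and F would exceed its maximum. *)
Lemma derive2_le0_of_max F (G : V -> R) p v d :
  (\forall h \near (0:R), is_derive (p + h *: v) v F (G (p + h *: v))) ->
  is_derive p v G d ->
  (\forall h \near (0:R), F (p + h *: v) <= F p) -> d <= 0.
Proof.
move=> FG /is_derive_cvg dG mF; rewrite leNgt; apply/negP => d0.
have FGp : is_derive p v F (G p).
  by have := nbhs_singleton FG; rewrite scale0r addr0.
have Gp0 : G p = 0.
  apply/eqP; rewrite eq_le; apply/andP; split.
    by apply: (derive_le0_of_right_max FGp); exact: cvg_within mF.
  by apply: (derive_ge0_of_left_max FGp); exact: cvg_within mF.
have G_gt0 : \forall h \near (0:R)^'+, 0 < G (p + h *: v).
  have : \forall h \near (0:R)^'+, 0 < h^-1 * (G (p + h *: v) - G p).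
    by apply: (cvgr_gt d) d0; exact: cvg_dnbhs_at_right dG.
  apply: filterS2 (nbhs_right_gt 0) => h h0.
  by rewrite Gp0 subr0 pmulr_rgt0 ?invr_gt0.
have : \forall h \near (0:R)^'+, [/\ is_derive (p + h *: v) v F (G (p + h *: v)),
    F (p + h *: v) <= F p & 0 < G (p + h *: v)].
  near=> h; split; near: h; [exact: cvg_within FG|exact: cvg_within mF|exact: G_gt0].
move=> /near_right_ex[e e0 He].
have [x /andP[]|c /andP[c0 ce] E] := @mvt_line F G p v e e0.
  rewrite le_eqVlt => /predU1P[<- _|x0 xe]; first by rewrite scale0r addr0.
  by have [|//] := He x; rewrite x0.
have [|_ m _] := He e; first by rewrite e0 lexx.
have [|_ _ g] := He c; first by rewrite c0 ltW.
by have := mulr_gt0 g e0; rewrite -E subr_gt0 ltNge m.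
Unshelve. all: by end_near. Qed.

(** The mean value theorem along u, applied to the increment of F along v, and
    then along v.  The left-hand side is symmetric in u and v, which is what
    identifies the two mixed derivatives. *)
Lemma second_difference F (Fu Fuv : V -> R) p u v (e : R) : 0 < e ->
  (forall s r, 0 <= s <= e -> 0 <= r <= e -> let q := p + s *: u + r *: v in
     is_derive q u F (Fu q) /\ is_derive q v Fu (Fuv q)) ->
  exists s r, [/\ 0 < s < e, 0 < r < e &
    F (p + e *: u + e *: v) - F (p + e *: u) - (F (p + e *: v) - F p) =
    Fuv (p + s *: u + r *: v) * e * e].
Proof.
move=> e0 dF.
pose Q q := F (q + e *: v) - F q; pose dQ q := Fu (q + e *: v) - Fu q.
have ee : 0 <= e <= e by rewrite ltW/=.
have [s se|s0 s0e EQ] := @mvt_line Q dQ p u e e0.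
  apply: is_deriveB.
    by apply: is_derive_translate; have [] := dF s e se ee.
  by have [] := dF s 0 se; rewrite ?lexx ?ltW// scale0r addr0.
have s0e' : 0 <= s0 <= e by case/andP: s0e => ? ?; rewrite !ltW.
have [r re|r0 r0e Er] := @mvt_line Fu Fuv (p + s0 *: u) v e e0.
  by have [] := dF s0 r s0e' re.
by exists s0, r0; split => //; rewrite -Er -EQ.
Qed.

Lemma near0_plane (P : set V) p u v : (\forall q \near p, P q) ->
  exists2 e : R, 0 < e & forall s r, 0 <= s <= e -> 0 <= r <= e ->
    P (p + s *: u + r *: v).
Proof.
move=> Pp.
have cp : (fun sr : R * R => p + sr.1 *: u + sr.2 *: v) @ (0, 0) --> p.
  rewrite -[X in _ --> X]addr0 -[X in _ --> X + _]addr0.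
  rewrite -[X in _ --> _ + X + _](scale0r u) -[X in _ --> _ + X](scale0r v).
  apply: cvgD; first apply: cvgD; first exact: cvg_cst.
    by apply: cvgZl; exact: cvg_fst.
  by apply: cvgZl; exact: cvg_snd.
have [[A B] /= [[a /= a0 aA] [b /= b0 bB]] AB] := cp _ Pp.
exists (Num.min a b / 2); first by rewrite divr_gt0// lt_min a0.
have H2 (c s : R) : 0 < c -> 0 <= s <= c / 2 -> `|0 - s| < c.
  move=> c0 /andP[s0 se]; rewrite sub0r normrN ger0_norm// (le_lt_trans se)//.
  by rewrite ltr_pdivrMr// ltr_pMr// ltrDl.
move=> s r /andP[s0 se] /andP[r0 re]; apply: (AB (s, r)); split => /=.
  apply: aA; apply: H2 => //; rewrite s0/= (le_trans se)//.
  by rewrite ler_pM2r// ge_min lexx.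
apply: bB; apply: H2 => //; rewrite r0/= (le_trans re)//.
by rewrite ler_pM2r// ge_min lexx orbT.
Qed.

(** In arbitrarily small rectangles based at p, Fuv at some point equals Fvu at
    some other point, since both are the same second difference divided by the
    area; continuity at p does the rest. *)
Lemma schwarz (U : set V) F (Fu Fv Fuv Fvu : V -> R) p u v : nbhs p U ->
  (forall q, U q ->
     [/\ is_derive q u F (Fu q), is_derive q v F (Fv q),
       is_derive q v Fu (Fuv q) & is_derive q u Fv (Fvu q)]) ->
  {for p, continuous Fuv} -> {for p, continuous Fvu} -> Fuv p = Fvu p.
Proof.
move=> Up dF cuv cvu; apply/eqP; apply/negP => /negP ne.
pose a := `|Fuv p - Fvu p| / 2.
have a0 : 0 < a by rewrite divr_gt0// normr_gt0 subr_eq0.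
have : \forall q \near p, [/\ U q, `|Fuv p - Fuv q| < a & `|Fvu p - Fvu q| < a].
  by near=> q; split; near: q => //; [move/cvgr_dist_lt : cuv; exact|move/cvgr_dist_lt : cvu; exact].
move=> /(near0_plane u v)[e e0 He].
have [s r se re|s [r [se re E]]] := @second_difference F Fu Fuv p u v e e0.
  by have [/dF[]] := He _ _ se re.
have [s' r' se' re'|r' [s' [re' se' E']]] := @second_difference F Fv Fvu p v u e e0.
  by have [/dF[]] := He _ _ re' se'; rewrite addrAC.
have {E'}E' : Fuv (p + s *: u + r *: v) = Fvu (p + s' *: u + r' *: v).
  apply: (mulIf (lt0r_neq0 e0)); apply: (mulIf (lt0r_neq0 e0)).
  by rewrite -E [p + s' *: u + _]addrAC -E' [p + e *: v + _]addrAC; ring.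
have W (x : R) : 0 < x < e -> 0 <= x <= e by move=> /andP[? ?]; rewrite !ltW.
have [_ + _] := He _ _ (W _ se) (W _ re); have [_ _ ] := He _ _ (W _ se') (W _ re').
rewrite E'; set y := Fvu (_ + _) => h1 h2.
have : `|Fuv p - Fvu p| < a + a.
  rewrite -[X in `|X|](subrKA y); apply: (le_lt_trans (ler_normD _ _)).
  by rewrite ltrD// distrC.
by rewrite -splitr ltxx.
Unshelve. all: by end_near. Qed.

End DirectionalCalculus.

(** * The maximum principle *)

Section Coordinates.
Context {R : realType} {V : normedModType R}.

Lemma is_derive_comp_coord (y : R -> R) (c : V -> R) p v d :
  (forall h, c (p + h *: v) = c p + h) ->
  is_derive (c p) 1 y d -> is_derive p v (fun q => y (c q)) d.
Proof.
move=> cv /is_derive_cvg dy; apply: is_derive_cvgP.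
apply: (cvg_trans _ dy); apply: near_eq_cvg; near=> h.
by rewrite cv [_%:A]mulr1.
Unshelve. all: by end_near. Qed.

Lemma is_derive_invariant (F : V -> R) p v :
  (forall h, F (p + h *: v) = F p) -> is_derive p v F 0.
Proof.
move=> Fv; apply: is_derive_cvgP; have : (fun=> 0 : R) @ (0:R)^' --> (0:R) by exact: cvg_cst.
apply: cvg_trans.
by apply: near_eq_cvg; near=> h; rewrite Fv subrr mulr0.
Unshelve. all: by end_near. Qed.

End Coordinates.

Lemma is_derive_expR_affine {R : realType} (k s c r : R) :
  is_derive r 1 (fun r => expR (k * (r - s)) * c) (expR (k * (r - s)) * k * c).
Proof.
have da : is_derive r 1 (k \*: (id - cst s)) k.
  by apply: is_derive_eq; rewrite subr0 [_%:A]mulr1.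
have := is_deriveM (is_derive1_comp (is_derive_expR _) da) (is_derive_cst c r 1).
by move=> /is_derive_eq; apply; rewrite scaler0 add0r /= /GRing.scale/=; ring.
Qed.

Section Comparison.
Context {R : realType}.
Implicit Types p q : R * R * R.

Lemma add_dir_tau (s x y h : R) : (s, x, y) + h *: dir_tau = (s + h, x, y).
Proof. by rewrite /dir_tau; congr (_, _, _) => /=; rewrite /GRing.scale/= ?mulr1 ?mulr0 ?addr0. Qed.

Lemma add_dir_xi (s x y h : R) : (s, x, y) + h *: dir_xi = (s, x + h, y).
Proof. by rewrite /dir_xi; congr (_, _, _) => /=; rewrite /GRing.scale/= ?mulr1 ?mulr0 ?addr0. Qed.

Lemma add_dir_eta (s x y h : R) : (s, x, y) + h *: dir_eta = (s, x, y + h).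
Proof. by rewrite /dir_eta; congr (_, _, _) => /=; rewrite /GRing.scale/= ?mulr1 ?mulr0 ?addr0. Qed.

Definition box (t x : R) : set (R * R * R) :=
  `[0, t] `*` `[0, x] `*` `[0, 1].

Lemma compact_box t x : compact (box t x).
Proof. by rewrite /box; do 2?apply: compact_setX; exact: segment_compact. Qed.

Lemma boxP t x s y e : box t x (s, y, e) <-> [/\ 0 <= s <= t, 0 <= y <= x & 0 <= e <= 1].
Proof. by rewrite /box /= !in_itv/=; split=> [[[]]|[]]. Qed.

(** A positive value of z would give a positive maximum of exp(- lam tau) z on
    the box.  The sign condition excludes it from the faces tau = 0, xi = 0 and
    eta = 1, and the positive slope from eta = 0.  Anywhere else, faces tau = t
    and xi = x included, one has zt >= lam z, zx >= 0 and zee <= 0 there, against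
    the strict inequality. *)
Lemma comparison (t x lam : R) (a z zt zx ze zee : R * R * R -> R) :
  {within box t x, continuous z} ->
  (forall s y e : R, box t x (s, y, e) -> [\/ s = 0, y = 0 | e = 1] ->
     z (s, y, e) <= 0) ->
  (forall s y : R, 0 < s <= t -> 0 < y <= x -> exists2 d : R, 0 < d &
     h^-1 * (z (s, y, h) - z (s, y, 0)) @[h --> 0^'+] --> d) ->
  (forall s y e : R, 0 < s <= t -> 0 < y <= x -> 0 < e < 1 -> let p := (s, y, e) in
     [/\ is_derive p dir_tau z (zt p), is_derive p dir_xi z (zx p),
        is_derive p dir_eta z (ze p), is_derive p dir_eta ze (zee p) &
        0 <= a p /\ (0 < z p -> zt p + e * zx p - a p * zee p < lam * z p)]) ->
  forall p, box t x p -> z p <= 0.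
Proof.
move=> zc zbd zeta0 zin p0 bp0.
pose E q := expR (- (lam * q.1.1)).
pose W q := E q * z q.
have Wc : {within box t x, continuous W}.
  move=> q; apply: cvgM; last exact: zc.
  apply: continuous_subspaceT => {}q; apply: continuous_comp; last exact: continuous_expR.
  apply: cvgN; apply: cvgMr.
  exact: (@continuous_comp _ _ _ fst fst q (@cvg_fst _ _ _ _ _) (@cvg_fst _ _ _ _ _)).
have [|[[s y] e] /set_mem bp Wmax] := compact_EVT_max _ (compact_box (t:=t) (x:=x)) Wc.
  by exists p0.
rewrite leNgt; apply/negP => zp0.
have zp : 0 < z (s, y, e).
  have : 0 < W (s, y, e).
    apply: lt_le_trans (Wmax p0 (mem_set bp0)).
    by rewrite /W mulr_gt0// expR_gt0.
  by rewrite /W pmulr_rgt0// expR_gt0.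
have nbd : ~ [\/ s = 0, y = 0 | e = 1].
  by move=> /(zbd _ _ _ bp); rewrite leNgt zp.
have /boxP[/andP[s0 st] /andP[y0 yx] /andP[e0 e1]] := bp.
have {}s0 : 0 < s by rewrite lt_neqAle s0 andbT eq_sym; apply/eqP => h; apply: nbd; exact: Or31.
have {}y0 : 0 < y by rewrite lt_neqAle y0 andbT eq_sym; apply/eqP => h; apply: nbd; exact: Or32.
have {}e1 : e < 1 by rewrite lt_neqAle e1 andbT; apply/eqP => h; apply: nbd; exact: Or33.
have zmaxE s' y' e' : box t x (s', y', e') ->
    z (s', y', e') <= expR (lam * (s' - s)) * z (s, y, e).
  move=> b'; have := Wmax _ (mem_set b'); rewrite /W/E/= => h.
  have -> : lam * (s' - s) = lam * s' - lam * s by ring.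
  rewrite expRD -mulrA -ler_pdivrMl ?expR_gt0// -expRN; exact: h.
have zmax y' e' : 0 <= y' <= x -> 0 <= e' <= 1 -> z (s, y', e') <= z (s, y, e).
  move=> hy he; have := zmaxE s y' e'; rewrite subrr mulr0 expR0 mul1r; apply.
  by apply/boxP; rewrite hy he ltW.
have [e00|e0'] := eqVneq e 0.
  have [||d d0 zd] := zeta0 s y; [by rewrite s0|by rewrite y0|].
  have : d <= 0.
    apply: (cvgr_to_le zd); near=> h.
    have h0 : 0 < h by near: h; exact: nbhs_right_gt.
    have h1 : h <= 1 by near: h; exact: nbhs_right_le.
    rewrite mulr_ge0_le0 ?invr_ge0 ?(ltW h0)// subr_le0 -[X in _ <= z (_, X)]e00.
    by apply: zmax; [rewrite ltW | rewrite ltW].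
  by rewrite leNgt d0.
have {e0' e0}e0 : 0 < e by rewrite lt_neqAle e0 eq_sym e0'.
have [|||zt_ zx_ ze_ zee_ [a0 /(_ zp)]] := zin s y e; [by rewrite s0|by rewrite y0|by rewrite e0|].
set p := (s, y, e) in zt_ zx_ ze_ zee_ a0 zp zmax *.
have zx0 : 0 <= zx p.
  apply: (derive_ge0_of_left_max zx_); near=> h.
  have h0 : h <= 0 by near: h; exact: nbhs_left_le.
  have hy : - y <= h.
    by near: h; apply: nbhs_left_ge; rewrite oppr_lt0.
  rewrite add_dir_xi; apply: zmax; last by rewrite !ltW.
  by apply/andP; split; lra.
have nearI : \forall h \near (0:R), 0 < e + h < 1.
  have m0 : 0 < Num.min e (1 - e) by rewrite lt_min e0 subr_gt0.
  exists (Num.min e (1 - e)) => //= h /=; rewrite sub0r normrN.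
  rewrite lt_min !ltr_norml => /andP[/andP[? ?] /andP[? ?]].
  by apply/andP; split; lra.
have zee0 : zee p <= 0.
  apply: (@derive2_le0_of_max _ _ z ze p dir_eta _ _ zee_).
    near=> h; rewrite add_dir_eta.
    by have [|||] := zin s y (e + h); rewrite ?s0 ?y0//; near: h.
  near=> h; rewrite add_dir_eta; apply: zmax; first by rewrite ltW.
  have /andP[? ?] : 0 < e + h < 1 by near: h.
  by rewrite !ltW.
have zt0 : lam * z p <= zt p.
  rewrite -subr_ge0.
  pose F (q : R * R * R) := z q - expR (lam * (q.1.1 - s)) * z p.
  apply: (@derive_ge0_of_left_max _ _ F p dir_tau).
    apply: is_deriveB.
    apply: (@is_derive_comp_coord _ _ (fun r => expR (lam * (r - s)) * z p) (fun q : R * R * R => q.1.1)) => [h|].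
      by rewrite add_dir_tau.
    rewrite (_ : lam * z p = expR (lam * (s - s)) * lam * z p); last first.
      by rewrite subrr mulr0 expR0 mul1r.
    by rewrite /p/=; apply: is_derive_expR_affine.
  near=> h.
  have h0 : h <= 0 by near: h; exact: nbhs_left_le.
  have hs : - s <= h.
    by near: h; apply: nbhs_left_ge; rewrite oppr_lt0.
  rewrite /F add_dir_tau /= subrr mulr0 expR0 mul1r subrr subr_le0.
  by apply: zmaxE; apply/boxP; split; rewrite ?(ltW e0) ?(ltW e1) ?(ltW y0)//; apply/andP; split; lra.
have := mulr_ge0 (ltW e0) zx0; have := mulr_ge0_le0 a0 zee0; lra.
Unshelve. all: by end_near. Qed.
End Comparison.

(** * Interior regularity *)

Section Interior.
Context {R : realType}.
Implicit Types (F G : R * R * R -> R) (p q v : R * R * R) (S U : set (R * R * R)).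

Definition is_dir v := [\/ v = dir_tau, v = dir_xi | v = dir_eta].

(** The counterpart of [class_C] with two-sided directional derivatives, for
    which the rules of calculus hold; U is meant to be open. *)
Fixpoint smooth U (k : nat) F : Prop :=
  (forall p, U p -> {for p, continuous F}) /\
  if k is k'.+1 then forall v, is_dir v ->
      (forall p, U p -> derivable F p v) /\ smooth U k' ('D_v F)
  else True.

Lemma line_cvg p v : p + h *: v @[h --> (0:R)] --> p.
Proof.
rewrite -[X in _ --> X]addr0 -(scale0r v).
by apply: cvgD; [exact: cvg_cst | apply: cvgZl; exact: cvg_id].
Qed.

Lemma within_cvg_line S F p v : {within S, continuous F} -> S p ->
  (\forall h \near (0:R)^'+, S (p + h *: v)) ->
  F (p + h *: v) @[h --> (0:R)^'+] --> F p.
Proof.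
move=> /subspace_continuousP/(_ p) Fc /Fc {}Fc Sv.
have lc := @line_cvg p v.
move=> A /Fc; rewrite /within/= => /lc; rewrite !nbhs_simpl /= => A0.
have A1 : \forall h \near (0:R)^'+, S (p + h *: v) -> A (F (p + h *: v)).
  by exact: cvg_within A0.
by apply: filterS2 Sv A1 => h Sh; apply.
Qed.

Lemma near_line U p v : nbhs p U -> \forall h \near (0:R), U (p + h *: v).
Proof.
move=> Up; have lc := @line_cvg p v.
exact: lc.
Qed.

Lemma increments_dnbhs S p v : (\forall h \near (0:R), S (p + h *: v)) ->
  increments S v p = (0:R)^'.
Proof.
move=> Sp; rewrite /increments; apply/seteqP; split => A; rewrite /within/=; last exact: filterS.
move=> hA; have : \forall h \near (0:R)^', S (p + h *: v) by exact: cvg_within Sp.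
by move: hA; apply: filterS2 => h; apply.
Qed.

Lemma derivable_on_is_derive S F p v : nbhs p S -> derivable_on S F v p ->
  is_derive p v F (deriv_on S v F p).
Proof.
move=> Sp dF; apply: is_derive_cvgP; rewrite -(increments_dnbhs (near_line v Sp)).
exact: dF.
Qed.

(** F and G are only required to agree on U because the induction passes from the
    one-sided derivative of F to the two-sided derivative of G, and these
    coincide on U but not on the whole of S. *)
Lemma class_C_smooth S U k F G : open U -> U `<=` S ->
  (forall p, U p -> F p = G p) -> class_C S k F -> smooth U k G.
Proof.
move=> oU US; have nU p : U p -> nbhs p U by move=> Up; exact: open_nbhs_nbhs.
have class_C_cont F' G' p : (forall q, U q -> F' q = G' q) ->
    {within S, continuous F'} -> U p -> {for p, continuous G'}.
  move=> FG' /subspace_continuousP Fc Up.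
  have FG2 : {near p, F' =1 G'} by apply: filterS (nU _ Up) => q /FG'.
  have cF : F' @ p --> G' p.
    rewrite -(FG' _ Up) => A /(Fc p (US _ Up)); rewrite /within/= => h.
    by apply: filterS2 (nU _ Up) h => q /US Sq; apply.
  by apply: cvg_trans cF; exact: near_eq_cvg.
elim: k F G => [|k IH] F G FG /= [Fc dF].
  by split=> // p Up; exact: (class_C_cont F).
split; first by move=> p Up; exact: (class_C_cont F).
move=> v /dF[dFv /IH IHv].
have GF p : U p -> is_derive p v G (deriv_on S v F p).
  move=> Up; have Sp : nbhs p S by apply: filterS US _; exact: nU.
  apply: (@near_eq_is_derive _ _ _ F); last by apply: derivable_on_is_derive => //; exact/dFv/US.
  by apply: filterS (nU _ Up) => q; exact: FG.
split; first by move=> p /GF[].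
by apply: IHv => p Up; have [] := GF p Up.
Qed.

Lemma smooth_schwarz U F p u v : open U -> smooth U 2 F -> is_dir u -> is_dir v ->
  U p -> 'D_u ('D_v F) p = 'D_v ('D_u F) p.
Proof.
move=> oU [_ /= sF] du dv Up.
have [dFu [_ dFu2]] := sF _ du; have [dFv [_ dFv2]] := sF _ dv.
have [dFuv [cuv _]] := dFu2 _ dv; have [dFvu [cvu _]] := dFv2 _ du.
apply: (@schwarz _ _ U F ('D_v F) ('D_u F) ('D_u ('D_v F)) ('D_v ('D_u F)) p v u).
- exact: open_nbhs_nbhs.
- by move=> q Uq; split; apply/derivableP; auto.
- exact: cvu.
- exact: cuv.
Qed.
End Interior.

(** * The linearized equation *)

Section Linearization.
Context {R : realType}.
Implicit Types (F G w : R * R * R -> R) (p q v : R * R * R) (X T : R).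

Definition interior_dom X : set (R * R * R) :=
  `]0, +oo[ `*` `]0, X[ `*` `]0, 1[.

Lemma interior_domP X (s y e : R) :
  interior_dom X (s, y, e) <-> [/\ 0 < s, 0 < y < X & 0 < e < 1].
Proof.
by rewrite /interior_dom /= !in_itv/= andbT; split=> [[[]]|[]].
Qed.

Lemma open_interior_dom X : open (interior_dom X).
Proof.
have openX (V W : topologicalType) (A : set V) (B : set W) :
    open A -> open B -> open (A `*` B).
  rewrite !openE => oA oB [a b] [/= Aa Bb].
  by exists (A, B) => //; split; [exact: oA|exact: oB].
by apply: (openX); [apply: (openX)|]; exact: interval_open.
Qed.

Lemma nbhs_interior_dom X p : interior_dom X p -> nbhs p (interior_dom X).
Proof. by move=> Up; apply: open_nbhs_nbhs; split=> //; exact: open_interior_dom. Qed.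

Lemma sub_dom X : interior_dom X `<=` dom X.
Proof.
move=> [[s y] e] /interior_domP[s0 /andP[? ?] /andP[? ?]].
by rewrite /dom /= !in_itv/= andbT; split; [split|]; rewrite ?ltW//; apply/andP; rewrite ?ltW.
Qed.

Lemma sub_dom_interior X : interior_dom X `<=` dom_interior X.
Proof.
move=> [[s y] e] /interior_domP[s0 /andP[? ?] /andP[? ?]].
by rewrite /dom_interior /= !in_itv/= andbT; split; [split|]; rewrite ?ltW//; apply/andP; rewrite ?ltW.
Qed.

Lemma deriv_on_interior X F v p : derivable_on (dom X) F v p ->
  interior_dom X p -> is_derive p v F (deriv_on (dom X) v F p).
Proof.
move=> dF Up; apply: derivable_on_is_derive dF.
by apply: filterS (nbhs_interior_dom Up); exact: sub_dom.
Qed.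

Lemma linearized_algebra (a a' b b' c c' d f e A w : R) :
  a = a' -> b = b' -> c = c' ->
  0 = - a - (e * b + d * 0) + (w ^+ 2 * c + A * (2 * w * f)) ->
  a' + e * b' - w ^+ 2 * c' = 2 * (w * A) * f.
Proof. by move=> -> -> -> ?; lra. Qed.

(** Since v is tau or xi, the coefficient eta is constant along v; differentiating
    the equation along v and exchanging derivatives gives the claim.  The bound
    s < T makes the equation hold on both sides of s. *)
Lemma crocco_linearized X T w v (s y e : R) :
  smooth (interior_dom X) 3 w ->
  (forall q, interior_dom X q -> q.1.1 <= T ->
     - 'D_dir_tau w q - q.2 * 'D_dir_xi w q
     + w q ^+ 2 * 'D_dir_eta ('D_dir_eta w) q = 0) ->
  v = dir_tau \/ v = dir_xi ->
  interior_dom X (s, y, e) -> s < T -> let q := (s, y, e) in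
  'D_dir_tau ('D_v w) q + e * 'D_dir_xi ('D_v w) q
   - w q ^+ 2 * 'D_dir_eta ('D_dir_eta ('D_v w)) q
  = 2 * (w q * 'D_dir_eta ('D_dir_eta w) q) * 'D_v w q.
Proof.
move=> sw Ew hv Uq sT q.
have oU := @open_interior_dom X.
have dv : is_dir v by case: hv => ->; [exact: Or31|exact: Or32].
have dt : is_dir (dir_tau : R * R * R) by exact: Or31.
have dx : is_dir (dir_xi : R * R * R) by exact: Or32.
have de : is_dir (dir_eta : R * R * R) by exact: Or33.
have [_ /= sw'] := sw.
have smW k F : smooth (interior_dom X) k.+1 F -> smooth (interior_dom X) k F.
  elim: k F => [|k IH] F [Fc]; first by split.
  by move=> h; split => // u du; have [? /IH ?] := h u du.
have sw2 : smooth (interior_dom X) 2 w by exact: smW.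
have se2 : smooth (interior_dom X) 2 ('D_dir_eta w) by have [] := sw' _ de.
pose E p := - 'D_dir_tau w p - p.2 * 'D_dir_xi w p + w p ^+ 2 * 'D_dir_eta ('D_dir_eta w) p.
have E0 : is_derive q v E 0.
  apply: (@near_eq_is_derive _ _ _ (cst 0)) (is_derive_cst _ _ _).
  have cs : {for q, continuous (fun p : R * R * R => p.1.1)}.
    exact: (@continuous_comp _ _ _ fst fst q (@cvg_fst _ _ _ _ _) (@cvg_fst _ _ _ _ _)).
  have nT : \forall p \near q, p.1.1 < T by exact: (cvgr_lt s cs).
  apply: filterS2 (nbhs_interior_dom Uq) nT => p Up pT.
  by rewrite /cst/= /E; apply/esym/Ew => //; exact: ltW.
have der F u : (forall p, interior_dom X p -> derivable F p u) -> is_derive q u F ('D_u F q).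
  by move=> dF; split=> //; exact: dF.
have d1 u u' : is_dir u -> is_dir u' -> is_derive q u ('D_u' w) ('D_u ('D_u' w) q).
  by move=> du du'; have [_ [_ /(_ _ du)[? _]]] := sw' _ du'; exact: (der ('D_u' w)).
have d0 : is_derive q v w ('D_v w q) by have [? _] := sw' _ dv; exact: der.
have d2 : is_derive q v ('D_dir_eta ('D_dir_eta w)) ('D_v ('D_dir_eta ('D_dir_eta w)) q).
  have [_ [_ /(_ _ de)[_ [_ /(_ _ dv)[? _]]]]] := sw' _ de.
  exact: (der ('D_dir_eta ('D_dir_eta w))).
have deta : is_derive q v (fun p : R * R * R => p.2) 0.
  apply: is_derive_invariant => h; case: hv => ->.
    by rewrite /q add_dir_tau.
  by rewrite /q add_dir_xi.
have := is_deriveD (is_deriveB (is_deriveN (d1 v dir_tau dv dt)) (is_deriveM deta (d1 v dir_xi dv dx)))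
   (is_deriveM (is_deriveX 2 d0) d2).
move=> [_ ]; have [_ ->] := E0.
rewrite /GRing.scale/= expr1.
have s1 : 'D_v ('D_dir_tau w) q = 'D_dir_tau ('D_v w) q by exact: (smooth_schwarz oU).
have s2 : 'D_v ('D_dir_xi w) q = 'D_dir_xi ('D_v w) q by exact: (smooth_schwarz oU).
have s3 : 'D_v ('D_dir_eta ('D_dir_eta w)) q = 'D_dir_eta ('D_dir_eta ('D_v w)) q.
  have nE : {near q, 'D_v ('D_dir_eta w) =1 'D_dir_eta ('D_v w)}.
    by apply: filterS (nbhs_interior_dom Uq) => p Up; exact: (smooth_schwarz oU).
  apply: (eq_trans (smooth_schwarz oU se2 dv de Uq)).
  exact: (near_eq_derive dir_eta nE).
by move=> E1; exact: (linearized_algebra s1 s2 s3 E1).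
Qed.

End Linearization.

(** * The boundary condition of the tangential derivatives *)

Section Boundary.
Context {R : realType}.
Implicit Types (F G w : R * R * R -> R) (p q v : R * R * R) (X T : R).

Lemma domP X (s y e : R) : dom X (s, y, e) <-> [/\ 0 <= s, 0 <= y <= X & 0 <= e < 1].
Proof. by rewrite /dom /= !in_itv/= andbT; split=> [[[]]|[]]. Qed.

Lemma dom_closedP X (s y e : R) :
  dom_closed X (s, y, e) <-> [/\ 0 <= s, 0 <= y <= X & 0 <= e <= 1].
Proof. by rewrite /dom_closed /= !in_itv/= andbT; split=> [[[]]|[]]. Qed.

Lemma deriv_on_interiorE X F v p : derivable_on (dom X) F v p ->
  interior_dom X p -> deriv_on (dom X) v F p = 'D_v F p.
Proof. by move=> dF /(deriv_on_interior dF)[]. Qed.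

Lemma deriv_on2_interiorE X F u v p : class_C (dom X) 2 F -> is_dir u -> is_dir v ->
  interior_dom X p ->
  deriv_on (dom X) u (deriv_on (dom X) v F) p = 'D_u ('D_v F) p.
Proof.
move=> [_ CF] du dv Up; have [dF [_ /(_ _ du)[ddF _]]] := CF _ dv.
rewrite (deriv_on_interiorE (ddF _ (sub_dom Up)) Up); apply: near_eq_derive.
apply: filterS (nbhs_interior_dom Up) => q Uq.
exact: deriv_on_interiorE (dF _ (sub_dom Uq)) Uq.
Qed.

Lemma within_eq_endpoint (S : set (R * R * R)) F G p v :
  {within S, continuous F} -> {within S, continuous G} -> S p ->
  (\forall h \near (0:R)^'+, S (p + h *: v) /\ F (p + h *: v) = G (p + h *: v)) ->
  F p = G p.
Proof.
move=> Fc Gc Sp near_v.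
have Sv : \forall h \near (0:R)^'+, S (p + h *: v) by apply: filterS near_v => h [].
have cF := within_cvg_line Fc Sp Sv; have cG := within_cvg_line Gc Sp Sv.
apply: (cvg_unique _ cF) => //; apply: (cvg_trans _ cG); apply: near_eq_cvg.
by apply: filterS near_v => h [].
Qed.

(** On the face eta = 0 the function w_eta vanishes, hence so does its derivative
    along v, which is tangential.  That mixed derivative agrees with the
    eta-derivative of w_v in the interior by Schwarz, and both are continuous up
    to the face, so they also agree there. *)
Lemma neumann_derivative X T w v (s y : R) : class_C (dom X) 2 w ->
  (forall s y : R, 0 <= s < T -> 0 <= y <= X ->
     deriv_on (dom X) dir_eta w (s, y, 0) = 0) ->
  v = dir_tau \/ v = dir_xi -> 0 < s < T -> 0 < y < X ->
  h^-1 * (deriv_on (dom X) v w (s, y, h) - deriv_on (dom X) v w (s, y, 0))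
    @[h --> (0:R)^'+] --> (0 : R).
Proof.
move=> Cw weta hv /andP[s0 sT] /andP[y0 yX].
have dv : is_dir v by case: hv => ->; [exact: Or31|exact: Or32].
have de : is_dir (dir_eta : R * R * R) by exact: Or33.
have [_ Cw'] := Cw; have [_ [_ /(_ _ de)[dvw [veta _]]]] := Cw' _ dv.
have [_ [_ /(_ _ dv)[_ [etav _]]]] := Cw' _ de.
have Dp : dom X (s, y, 0) 
  by apply/domP; split; [exact: ltW | apply/andP; split; exact: ltW | rewrite lexx ltr01].
have sw : smooth (interior_dom X) 2 w.
  by apply: (class_C_smooth _ _ _ Cw) => //; [exact: open_interior_dom|exact: sub_dom].
have near1 : \forall h \near (0:R)^'+, 0 < h < 1.
  by near=> h; apply/andP; split; near: h; [exact: nbhs_right_gt|exact: nbhs_right_lt].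
have E : deriv_on (dom X) dir_eta (deriv_on (dom X) v w) (s, y, 0) =
         deriv_on (dom X) v (deriv_on (dom X) dir_eta w) (s, y, 0).
  apply: (within_eq_endpoint (v := dir_eta) veta etav Dp).
  apply: filterS near1 => h h01; rewrite add_dir_eta add0r.
  have Uh : interior_dom X (s, y, h) by apply/interior_domP; split => //; apply/andP.
  split; first exact: sub_dom.
  apply: (eq_trans (deriv_on2_interiorE Cw de dv Uh)).
  apply: (eq_trans _ (esym (deriv_on2_interiorE Cw dv de Uh))).
  exact: (smooth_schwarz (@open_interior_dom _ X) sw de dv Uh).
have E0 : deriv_on (dom X) v (deriv_on (dom X) dir_eta w) (s, y, 0) = 0.
  have nv : \forall h \near (0:R), dom X ((s, y, 0) + h *: v) /\ deriv_on (dom X) dir_eta w ((s, y, 0) + h *: v) = 0.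
    pose m := Num.min (Num.min s (T - s)) (Num.min y (X - y)).
    have m0 : 0 < m by rewrite !lt_min s0 y0 !subr_gt0 sT.
    exists m => //= h /=; rewrite sub0r normrN /m !lt_min !ltr_norml.
    move=> /andP[/andP[/andP[? ?] /andP[? ?]] /andP[/andP[? ?] /andP[? ?]]].
    have sh : 0 <= s + h < T by apply/andP; split; lra.
    have yh : 0 <= y + h <= X by apply/andP; split; lra.
    have sI : 0 <= s < T by rewrite ltW.
    have yI : 0 <= y <= X by rewrite !ltW.
    case: hv => ->; [rewrite add_dir_tau|rewrite add_dir_xi]; split; try exact: weta.
      by apply/domP; split; rewrite ?lexx ?ltr01//; case/andP: sh.
    by apply/domP; split; rewrite ?lexx ?ltr01//; exact: ltW.
  have nv' : \forall h \near (0:R)^', deriv_on (dom X) dir_eta w ((s, y, 0) + h *: v) = 0.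
    have nv0 : \forall h \near (0:R), deriv_on (dom X) dir_eta w ((s, y, 0) + h *: v) = 0.
      by apply: filterS nv => h [].
    exact: cvg_within nv0.
  have e0 : deriv_on (dom X) dir_eta w (s, y, 0) = 0.
    by apply: weta; rewrite ?ltW//= ltW.
  have c0 : diff_quot (deriv_on (dom X) dir_eta w) v (s, y, 0) @ (0:R)^' --> (0:R).
    apply: cvg_near_cst.
    by apply: filterS nv' => h hE; rewrite /diff_quot hE e0 subrr mulr0.
  rewrite [LHS]/deriv_on increments_dnbhs; last by apply: filterS nv => h [].
  exact/cvg_lim.
rewrite E0 in E.
have d0 : diff_quot (deriv_on (dom X) v w) dir_eta (s, y, 0)
    @ increments (dom X) dir_eta (s, y, 0) --> (0:R).
  by rewrite -[X in _ --> X]E; exact: dvw.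
move=> A /d0 iA.
have nS : \forall h \near (0:R)^'+, dom X ((s, y, 0) + h *: dir_eta).
  apply: filterS near1 => h /andP[h0 h1]; rewrite add_dir_eta add0r.
  by apply/domP; split; [exact: ltW | apply/andP; split; exact: ltW | rewrite ltW].
have iA' : \forall h \near (0:R)^'+, dom X ((s, y, 0) + h *: dir_eta) ->
     A (diff_quot (deriv_on (dom X) v w) dir_eta (s, y, 0) h).
  have {}iA : \forall h \near (0:R)^', dom X ((s, y, 0) + h *: dir_eta) ->
     A (diff_quot (deriv_on (dom X) v w) dir_eta (s, y, 0) h) by exact: iA.
  move: iA; rewrite !near_withinE; apply: filterS => h hA h0.
  by apply: hA; rewrite gt_eqF.
have : \forall h \near (0:R)^'+, A (diff_quot (deriv_on (dom X) v w) dir_eta (s, y, 0) h).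
  by apply: filterS2 nS iA' => h Sh; apply.
have qE h : diff_quot (deriv_on (dom X) v w) dir_eta (s, y, 0) h =
   h^-1 * (deriv_on (dom X) v w (s, y, h) - deriv_on (dom X) v w (s, y, 0)).
  by rewrite /diff_quot add_dir_eta add0r.
by rewrite (funext qE).
Unshelve. all: by end_near.
Qed.

End Boundary.

(** * Continuity up to the boundary, and two scalar derivatives *)

Section Closure.
Context {R : realType}.
Implicit Types (F G w : R * R * R -> R) (p q v : R * R * R) (X T : R).

Lemma segment_in (l u a b h : R) : l <= a <= u -> l <= b <= u -> 0 <= h <= 1 ->
  l <= a + h * (b - a) <= u.
Proof. by move=> /andP[? ?] /andP[? ?] /andP[? ?]; apply/andP; split; nra. Qed.

Lemma segment_in_open (x u a c h : R) : x <= a <= u -> x < c < u -> 0 < h < 1 ->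
  x < a + h * (c - a) < u.
Proof.
move=> /andP[xa au] /andP[xc cu] /andP[h0 h1].
have k1 : 0 <= (1 - h) * (a - x) by rewrite mulr_ge0// subr_ge0// ltW.
have k2 : 0 < h * (c - x) by rewrite mulr_gt0// subr_gt0.
have k3 : 0 <= (1 - h) * (u - a) by rewrite mulr_ge0// subr_ge0// ltW.
have k4 : 0 < h * (u - c) by rewrite mulr_gt0// subr_gt0.
by apply/andP; split; lra.
Qed.

Lemma segment_coordE (s y e s' y' e' h : R) :
  (s, y, e) + h *: ((s', y', e') - (s, y, e)) =
  (s + h * (s' - s), y + h * (y' - y), e + h * (e' - e)).
Proof. by []. Qed.

(** Transfers to the closed domain the inequalities proved at interior points: the
    segment is aimed at an interior point, or stays in a face when the
    inequality is only known there. *)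
Lemma le0_closure X G (s y e s' y' e' : R) : {within dom_closed X, continuous G} ->
  dom_closed X (s, y, e) -> dom_closed X (s', y', e') ->
  (forall h : R, 0 < h < 1 ->
     G (s + h * (s' - s), y + h * (y' - y), e + h * (e' - e)) <= 0) ->
  G (s, y, e) <= 0.
Proof.
move=> Gc Dp Dc GN.
have near1 : \forall h \near (0:R)^'+, 0 < h < 1.
  by near=> h; apply/andP; split; near: h; [exact: nbhs_right_gt|exact: nbhs_right_lt].
have SD : \forall h \near (0:R)^'+, dom_closed X ((s, y, e) + h *: ((s', y', e') - (s, y, e))).
  apply: filterS near1 => h /andP[h0 h1]; rewrite segment_coordE; apply/dom_closedP.
  have h01 : 0 <= h <= 1 by rewrite !ltW.
  move: Dp Dc => /dom_closedP[s0 yy ee] /dom_closedP[s0' yy' ee'].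
  by split; [nra | exact: segment_in | exact: segment_in].
apply: (cvgr_to_le (within_cvg_line Gc Dp SD)).
by apply: filterS near1 => h /GN; rewrite segment_coordE.
Unshelve. all: by end_near. Qed.

End Closure.

Section Power.
Context {R : realType}.

Lemma within_continuous_powR (a : R) : 0 < a ->
  {within `[0, +oo[, continuous (fun r : R => r `^ a)}.
Proof.
move=> a0; apply/subspace_continuousP => x; rewrite /= in_itv/= andbT le_eqVlt.
case/predU1P => [<-|x0].
  have : (fun r : R => r `^ a) r @[r --> within (fun u => 0 <= u) (nbhs (0:R))] --> (0:R) `^ a.
    by apply: cvg_at_right_within; rewrite powR0 ?gt_eqF//; exact: powR_cvg0.
  apply: cvg_trans; apply: cvg_app; apply: within_subset => r /=.
  by rewrite in_itv/= andbT.
have /derivable1_diffP/differentiable_continuous c : derivable (fun r : R => r `^ a) x 1.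
  by have [] := is_derive1_powR a x0.
exact: cvg_within_filter c.
Qed.

Lemma is_derive_powR_refl (K a e : R) : e < 1 ->
  is_derive e 1 (fun r => K * (1 - r) `^ a) (- (K * a) * (1 - e) `^ (a - 1)).
Proof.
move=> e1; have e1' : 0 < 1 - e by rewrite subr_gt0.
have da : is_derive e 1 (cst 1 - id : R -> R) (-1).
  by apply: is_derive_eq; rewrite sub0r.
have := is_deriveM (is_derive_cst K e 1) (@is_derive1_comp R (fun r : R => r `^ a) (cst 1 - id) e _ _ (is_derive1_powR a e1') da).
by move=> /is_derive_eq; apply; rewrite scaler0 addr0 /= /GRing.scale/=; ring.
Qed.

Lemma is_derive_quadratic (m e : R) :
  is_derive e 1 (fun r => (1 - r) + m * (1 - r ^+ 2)) (- 1 - 2 * m * e).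
Proof.
have d1 : is_derive e 1 (cst 1 - id : R -> R) (-1).
  by apply: is_derive_eq; rewrite sub0r.
have d2 : is_derive e 1 (m \*: (cst 1 - id ^+ 2) : R -> R) (- 2 * m * e).
  by apply: is_derive_eq; rewrite sub0r /GRing.scale/=; ring.
by have := is_deriveD d1 d2; move=> /is_derive_eq; apply; ring.
Qed.

End Power.

(** * Comparison with supersolutions *)

Section Barriers.
Context {R : realType}.
Implicit Types (f phi w M : R * R * R -> R) (p q v : R * R * R) (X T : R).

(** The derivative in eta at the boundary point (s, y, 0). *)
Definition right_slope f (s y d : R) : Prop :=
  h^-1 * (f (s, y, h) - f (s, y, 0)) @[h --> (0:R)^'+] --> d.

(** The derivatives are given as functions because the second one in eta is the
    derivative of the first. *)
Record transport_derivatives X T (f ft fx fe fee : R * R * R -> R) : Prop := {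
  td_tau : forall q, interior_dom X q -> q.1.1 < T -> is_derive q dir_tau f (ft q);
  td_xi : forall q, interior_dom X q -> q.1.1 < T -> is_derive q dir_xi f (fx q);
  td_eta : forall q, interior_dom X q -> q.1.1 < T -> is_derive q dir_eta f (fe q);
  td_eta2 : forall q, interior_dom X q -> q.1.1 < T -> is_derive q dir_eta fe (fee q) }.

(** The problem solved by the derivatives of w along tau and xi: linear, of zeroth
    order coefficient 2 M, with homogeneous Neumann condition at eta = 0. *)
Definition linearized X T w M f : Prop :=
  [/\ {within dom_closed X, continuous f},
    forall s y : R, 0 < s < T -> 0 < y < X -> right_slope f s y 0 &
    exists ft fx fe fee, transport_derivatives X T f ft fx fe fee /\
      forall q, interior_dom X q -> q.1.1 < T ->
        ft q + q.2 * fx q - w q ^+ 2 * fee q = 2 * M q * f q].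

Definition strict_supersolution X T w M phi : Prop :=
  [/\ {within dom_closed X, continuous phi},
    forall s y : R, 0 < s < T -> 0 < y < X -> exists2 d, d < 0 & right_slope phi s y d &
    exists pt px pe pee, transport_derivatives X T phi pt px pe pee /\
      forall q, interior_dom X q -> q.1.1 < T ->
        2 * M q * phi q < pt q + q.2 * px q - w q ^+ 2 * pee q].

Lemma linearized_scale X T w M f (k : R) :
  linearized X T w M f -> linearized X T w M (fun q => k * f q).
Proof.
move=> [fc f0 [ft [fx [fe [fee [[dt dx de dee] Ef]]]]]]; split.
- by move=> q; apply: cvgM; [exact: cvg_cst | exact: fc].
- move=> s y hs hy; rewrite /right_slope.
  rewrite (_ : (fun h => _) = (fun h => k * (h^-1 * (f (s, y, h) - f (s, y, 0))))).
    by rewrite -[X in _ --> X](mulr0 k); apply: cvgM; [exact: cvg_cst | exact: f0].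
  by apply/funext => h; rewrite mulrCA -mulrBr.
exists (fun q => k * ft q), (fun q => k * fx q), (fun q => k * fe q), (fun q => k * fee q).
have dk (g g' : R * R * R -> R) q v :
  is_derive q v g (g' q) -> is_derive q v (fun q => k * g q) (k * g' q) by exact: is_deriveZ.
split; first by split=> q Uq sT; apply: dk; [exact: dt|exact: dx|exact: de|exact: dee].
by move=> q Uq sT; have := Ef q Uq sT; move=> E; transitivity (k * (2 * M q * f q)); [rewrite -E|]; ring.
Qed.

Lemma linearizedD X T w M f g :
  linearized X T w M f -> linearized X T w M g -> linearized X T w M (fun q => f q + g q).
Proof.
move=> [fc f0 [ft [fx [fe [fee [[dt dx de dee] Ef]]]]]].
move=> [gc g0 [gt [gx [ge [gee [[dt' dx' de' dee'] Eg]]]]]]; split.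
- by move=> q; apply: cvgD; [exact: fc | exact: gc].
- move=> s y hs hy; rewrite /right_slope.
  rewrite (_ : (fun h => _) = (fun h => h^-1 * (f (s, y, h) - f (s, y, 0)) +
       h^-1 * (g (s, y, h) - g (s, y, 0)))); last by apply/funext => h; ring.
  by rewrite -[X in _ --> X](addr0 0); apply: cvgD; [exact: f0 | exact: g0].
exists (fun q => ft q + gt q), (fun q => fx q + gx q), (fun q => fe q + ge q), (fun q => fee q + gee q).
split; first by split=> q Uq sT; apply: is_deriveD; auto.
move=> q Uq sT; have := Ef q Uq sT; have := Eg q Uq sT; lra.
Qed.

(** The constant 2 kap dominates the zeroth order coefficient 2 M, so it can be the
    exponential rate in the maximum principle applied to f - phi.  Boxes with
    tau < T and xi < X are used first, and the remaining faces follow by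
    continuity. *)
Lemma linearized_le X T w M f phi (kap : R) :
  0 < T -> 0 < X ->
  linearized X T w M f -> strict_supersolution X T w M phi ->
  (forall q, interior_dom X q -> q.1.1 < T -> M q <= kap) ->
  (forall s y e : R, 0 <= s <= T -> 0 <= y <= X -> 0 <= e <= 1 ->
     [\/ s = 0, y = 0 | e = 1] -> f (s, y, e) <= phi (s, y, e)) ->
  forall s y e : R, 0 <= s <= T -> 0 <= y <= X -> 0 <= e <= 1 ->
    f (s, y, e) <= phi (s, y, e).
Proof.
move=> T0 X0 [fc f0 [ft [fx [fe [fee [[dt dx de dee] Ef]]]]]].
move=> [gc g0 [gt [gx [ge [gee [[dt' dx' de' dee'] Eg]]]]]] Mk bd.
pose z q := f q - phi q.
have zc : {within dom_closed X, continuous z}.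
  by move=> q; apply: cvgB; [exact: fc | exact: gc].
have zin (s y e : R) : 0 <= s < T -> 0 <= y < X -> 0 <= e <= 1 -> z (s, y, e) <= 0.
  move=> /andP[s0 sT] /andP[y0 yX] /andP[e0 e1].
  have sub (q : R * R * R) : box s y q -> dom_closed X q.
    by move: q => [[s' y'] e'] /boxP[/andP[? ?] /andP[? ?] ?]; apply/dom_closedP; split=> //;
       apply/andP; split=> //; lra.
  apply: (@comparison _ s y (2 * kap) (fun q => w q ^+ 2) z
     (fun q => ft q - gt q) (fun q => fx q - gx q) (fun q => fe q - ge q)
     (fun q => fee q - gee q)).
  - exact: continuous_subspaceW zc.
  - move=> s' y' e' /boxP[/andP[? ?] /andP[? ?] ?] h; rewrite /z subr_le0; apply: bd => //.
      by apply/andP; split => //; lra.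
    by apply/andP; split => //; lra.
  - move=> s' y' /andP[? ?] /andP[? ?].
    have hs : 0 < s' < T by apply/andP; split => //; lra.
    have hy : 0 < y' < X by apply/andP; split => //; lra.
    have [d d0 gd] := g0 s' y' hs hy; exists (- d); first by rewrite oppr_gt0.
    rewrite (_ : (fun h => _) = (fun h => h^-1 * (f (s', y', h) - f (s', y', 0)) -
       h^-1 * (phi (s', y', h) - phi (s', y', 0)))); last first.
      by apply/funext => h; rewrite /z; ring.
    by rewrite -[X in _ --> X]sub0r; apply: cvgB; [exact: f0 | exact: gd].
  - move=> s' y' e' /andP[? ?] /andP[? ?] he p.
    have Up : interior_dom X p by apply/interior_domP; split => //; apply/andP; split => //; lra.
    have pT : p.1.1 < T by rewrite /=; lra.
    split; try (apply: is_deriveB; by auto).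
    split; first exact: sqr_ge0.
    move=> zp; have := Ef p Up pT; have := Eg p Up pT; have := Mk p Up pT.
    rewrite /z in zp *.
    have -> : p.2 = e' by [].
    nra.
  - by apply/boxP; rewrite !lexx s0 y0 e0 e1.
move=> s y e hs hy he; rewrite -subr_le0 -/(z (s, y, e)).
apply: (@le0_closure _ X z s y e 0 0 e zc).
- by apply/dom_closedP; split=> //; case/andP: hs.
- by apply/dom_closedP; split=> //; rewrite lexx ltW.
move=> h /andP[h0 h1]; rewrite subrr mulr0 addr0 !sub0r !mulrN.
case/andP: hs => ? ?; case/andP: hy => ? ?.
by apply: zin => //; apply/andP; split; nra.
Qed.

End Barriers.

(** * Explicit supersolutions *)

Section ExplicitBarriers.
Context {R : realType}.
Implicit Types (f phi w M : R * R * R -> R) (p q v : R * R * R) (X T : R).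

Lemma right_slope_of_derive f (s y d : R) :
  is_derive (s, y, 0) dir_eta f d -> right_slope f s y d.
Proof.
move=> /is_derive_cvg/cvg_dnbhs_at_right; rewrite /right_slope.
rewrite (_ : (fun h => _) = (fun h => h^-1 * (f (s, y, h) - f (s, y, 0))))//.
by apply/funext => h; rewrite add_dir_eta add0r.
Qed.

Lemma is_derive_of_eta (g : R -> R) q d :
  is_derive q.2 1 g d -> is_derive q dir_eta (fun q => g q.2) d.
Proof. 
by move: q => [[s y] e]; apply: is_derive_comp_coord => h; rewrite add_dir_eta. 
Qed.

Definition power_barrier (C a : R) q := C * (1 - q.2) `^ a.

Lemma within_continuous_power_barrier X C a : 0 < a ->
  {within dom_closed X, continuous (power_barrier C a)}.
Proof.
move=> a0; have /subspace_continuousP pc := within_continuous_powR a0.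
apply/subspace_continuousP => q Dq; apply: cvgM; first exact: cvg_cst.
have c1 : (fun p : R * R * R => 1 - p.2) p @[p --> q] --> 1 - q.2.
  by apply: cvgB; [exact: cvg_cst | exact: cvg_snd].
have dom0 p : dom_closed X p -> `[0, +oo[%classic (1 - p.2).
  by move: p => [[s y] e] /dom_closedP[_ _ /andP[_ e1]]; rewrite /= in_itv/= andbT subr_ge0.
move=> A /(pc _ (dom0 _ Dq)) hA.
have {}hA : \forall r \near 1 - q.2, `[0, +oo[%classic r -> A (r `^ a) by exact: hA.
have hA' : \forall p \near q, `[0, +oo[%classic (1 - p.2) -> A ((1 - p.2) `^ a).
  exact: (c1 _ hA).
have : \forall p \near q, dom_closed X p -> A ((1 - p.2) `^ a).
  by move: hA'; apply: filterS => p h Dp; apply: h; exact: dom0.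
by [].
Qed.

(** With r = 1 - eta, the second derivative contributes
    C a (1 - a) w^2 r^(a - 2) >= C a (1 - a) b^2 r^a, while the zeroth order term
    is at most kap C r^a. *)
Lemma power_supersolution X T w M (C a b kap : R) :
  0 < C -> 0 < a < 1 -> 0 < b -> kap < a * (1 - a) * b ^+ 2 ->
  (forall q, interior_dom X q -> q.1.1 < T -> b * (1 - q.2) <= w q /\ 2 * M q <= kap) ->
  strict_supersolution X T w M (power_barrier C a).
Proof.
move=> C0 /andP[a0 a1] b0 hk Hw; split; first exact: within_continuous_power_barrier.
  move=> s y _ _; exists (- (C * a) * (1 - 0) `^ (a - 1)).
    by rewrite subr0 powR1 mulr1 oppr_lt0 mulr_gt0.
  by apply: right_slope_of_derive; apply: (@is_derive_of_eta (fun r => C * (1 - r) `^ a) (s, y, 0)); exact: is_derive_powR_refl.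
exists (cst 0), (cst 0), (power_barrier (- (C * a)) (a - 1)),
  (power_barrier (- (- (C * a) * (a - 1))) (a - 1 - 1)).
split.
  split=> -[[s y] e] /interior_domP[_ _ /andP[_ e1]] _.
  - by apply: is_derive_invariant => h; rewrite add_dir_tau.
  - by apply: is_derive_invariant => h; rewrite add_dir_xi.
  - by apply: (@is_derive_of_eta (fun r => C * (1 - r) `^ a) (s, y, e)); exact: is_derive_powR_refl.
  - by apply: (@is_derive_of_eta (fun r => (- (C * a)) * (1 - r) `^ (a - 1)) (s, y, e)); exact: is_derive_powR_refl.
move=> q Uq qT; have [bw Mk] := Hw q Uq qT.
move: q Uq qT bw Mk => [[s y] e] /interior_domP[_ _ /andP[_ e1]] _.
rewrite /power_barrier /cst /= mulr0 addr0 sub0r.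
set W := w _; set m := M _ => bw Mk.
have r0 : 0 < 1 - e by rewrite subr_gt0.
have -> : (1 - e) `^ a = (1 - e) ^+ 2 * (1 - e) `^ (a - 1 - 1).
  rewrite -[X in X * _]powR_mulrn ?(ltW r0)// -powRD; last by rewrite (gt_eqF r0) implybT.
  by rewrite (_ : 2%:R + (a - 1 - 1) = a)//; ring.
have P0 : 0 < (1 - e) `^ (a - 1 - 1) by rewrite powR_gt0.
set P := _ `^ _ in P0 *.
have w2 : (b * (1 - e)) ^+ 2 <= W ^+ 2.
  by rewrite lerXn2r// nnegrE ?mulr_ge0 ?(ltW b0) ?(ltW r0)// (le_trans _ bw)// mulr_ge0 ?ltW.
have aa : 0 < a * (1 - a) by rewrite mulr_gt0// subr_gt0.
have h1 : 2 * m * (1 - e) ^+ 2 < a * (1 - a) * W ^+ 2.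
  apply: (lt_le_trans (y := a * (1 - a) * (b * (1 - e)) ^+ 2)); last by rewrite ler_pM2l.
  by rewrite exprMn [X in _ < X]mulrA ltr_pM2r ?exprn_gt0// (le_lt_trans Mk).
have -> : 2 * m * (C * ((1 - e) ^+ 2 * P)) = (C * P) * (2 * m * (1 - e) ^+ 2) by ring.
have -> : - (W ^+ 2 * (- (- (C * a) * (a - 1)) * P)) = (C * P) * (a * (1 - a) * W ^+ 2) by ring.
by rewrite ltr_pM2l// mulr_gt0.
Qed.

Definition transport_barrier (A m : R) q := A * expR q.1.2 * ((1 - q.2) + m * (1 - q.2 ^+ 2)).

(** Divided by A e^xi, the inequality to prove follows from
    4 d k < eta k + 6 d (1 - eta), where (1 - eta) k is the profile and
    6 d = 2 m b^2 comes from its second derivative.  For eta >= 4 d the first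
    term on the right is enough; otherwise 1 - eta is almost 1 and k is at most
    115/100, so the second one is. *)
Lemma transport_supersolution X T w M (A m b d : R) :
  0 < A -> 0 < b -> 0 < d <= 321^-1 -> m * b ^+ 2 = 3 * d -> 0 <= 2 * m <= 15 / 100 ->
  (forall q, interior_dom X q -> q.1.1 < T -> b * (1 - q.2) <= w q /\ 2 * M q <= 4 * d) ->
  strict_supersolution X T w M (transport_barrier A m).
Proof.
move=> A0 b0 /andP[d0 d1] mb /andP[m0 m1] Hw.
pose g (r : R) := (1 - r) + m * (1 - r ^+ 2).
have deta (s y e : R) (h : R -> R) d' : is_derive e 1 h d' ->
    is_derive (s, y, e) dir_eta (fun q => A * expR q.1.2 * h q.2) (A * expR y * d').
  move=> dh; have cy : is_derive (s, y, e) dir_eta (fun q : R * R * R => A * expR q.1.2) 0.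
    by apply: is_derive_invariant => r; rewrite add_dir_eta.
  have := is_deriveM cy (@is_derive_of_eta h (s, y, e) d' dh).
  by move=> /is_derive_eq; apply; rewrite scaler0 addr0.
have dxi (s y e : R) : is_derive (s, y, e) dir_xi (transport_barrier A m) (transport_barrier A m (s, y, e)).
  have dA : is_derive y 1 (A \*: expR) (A * expR y).
    by apply: is_derive_eq.
  have cA : is_derive (s, y, e) dir_xi (fun q : R * R * R => A * expR q.1.2) (A * expR y).
    apply: (@is_derive_comp_coord _ _ (A \*: expR) (fun q : R * R * R => q.1.2)) => // r.
    by rewrite add_dir_xi.
  have cg : is_derive (s, y, e) dir_xi (fun q : R * R * R => g q.2) 0.
    by apply: is_derive_invariant => r; rewrite add_dir_xi.
  have := is_deriveM cA cg.
  by move=> /is_derive_eq; apply; rewrite scaler0 add0r /transport_barrier /GRing.scale/= mulrC.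
split.
- apply: continuous_subspaceT => q; apply: cvgM; first apply: cvgM; first exact: cvg_cst.
    apply: continuous_comp; last exact: continuous_expR.
    exact: (@continuous_comp _ _ _ fst snd q (@cvg_fst _ _ _ _ _) (@cvg_snd _ _ _ _ _)).
  have c2 : {for q, continuous (fun q : R * R * R => q.2)} by exact: cvg_snd.
  apply: cvgD; first by apply: cvgB; [exact: cvg_cst | exact: c2].
  apply: cvgM; first exact: cvg_cst.
  by apply: cvgB; [exact: cvg_cst | apply: cvgM; exact: c2].
- move=> s y _ _; exists (A * expR y * (- 1 - 2 * m * 0)).
    by rewrite mulr0 subr0 mulrN1 oppr_lt0 mulr_gt0// expR_gt0.
  by apply: right_slope_of_derive; exact: (deta s y 0 g _ (is_derive_quadratic m 0)).
exists (cst 0), (transport_barrier A m), (fun q => A * expR q.1.2 * (- 1 - 2 * m * q.2)),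
  (fun q => A * expR q.1.2 * (- (2 * m))).
split.
  split=> -[[s y] e] _ _.
  - by apply: is_derive_invariant => h; rewrite add_dir_tau.
  - exact: dxi.
  - exact: (deta s y e g _ (is_derive_quadratic m e)).
  - apply: (deta s y e (fun r => - 1 - 2 * m * r) (- (2 * m))).
    have dl : is_derive e 1 ((- (2 * m)) \*: id - cst 1 : R -> R) (- (2 * m)).
      by apply: is_derive_eq; rewrite subr0 [_%:A]mulr1.
    apply: (@near_eq_is_derive _ _ _ _ _ _ _ _ _ dl).
    near=> r; rewrite !fctE; transitivity (- (2 * m) * r - 1) => //; ring.
move=> q Uq qT; have [bw Mk] := Hw q Uq qT.
move: q Uq qT bw Mk => [[s y] e] /interior_domP[_ _ /andP[e0 e1]] _.
rewrite /transport_barrier /cst /= add0r.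
set W := w _; set n := M _ => bw Mk.
have r0 : 0 < 1 - e by rewrite subr_gt0.
have w2 : (b * (1 - e)) ^+ 2 <= W ^+ 2.
  by rewrite lerXn2r// nnegrE ?mulr_ge0 ?(ltW b0) ?(ltW r0)// (le_trans _ bw)// mulr_ge0 ?ltW.
have E0 : 0 < A * expR y by rewrite mulr_gt0// expR_gt0.
set E := A * expR y in E0 *.
pose k := 1 + m * (1 + e).
have -> : 1 - e + m * (1 - e ^+ 2) = (1 - e) * k by rewrite /k; ring.
have m0' : 0 <= m by lra.
have k1 : 1 <= k by rewrite /k; nra.
have k2 : k <= 115 / 100 by rewrite /k; nra.
suff : 2 * n * ((1 - e) * k) < e * ((1 - e) * k) + 2 * m * W ^+ 2.
  move=> h; rewrite -subr_gt0 in h; rewrite -subr_gt0.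
  have := mulr_gt0 E0 h; congr (0 < _); ring.
have h1 : 2 * n * ((1 - e) * k) <= 4 * d * ((1 - e) * k).
  by rewrite ler_wpM2r// mulr_ge0 ?ltW//; lra.
have h2 : 2 * m * (b * (1 - e)) ^+ 2 <= 2 * m * W ^+ 2 by rewrite ler_wpM2l.
have h3 : 2 * m * (b * (1 - e)) ^+ 2 = (1 - e) * (6 * d * (1 - e)).
  have -> : 2 * m * (b * (1 - e)) ^+ 2 = 2 * (m * b ^+ 2) * (1 - e) ^+ 2 by ring.
  by rewrite mb; ring.
suff h4 : 4 * d * k < e * k + 6 * d * (1 - e).
  have := h4; rewrite -(ltr_pM2l r0) => h5; lra.
have [he|he] := leP (4 * d) e.
  have := mulr_gt0 d0 r0; nra.
nra.
Unshelve. all: by end_near. Qed.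

End ExplicitBarriers.

(** * The constants *)

Section Constants.
Context {R : realType}.
Variables (X c0 alpha0 C1 beta : R).
Let b := const_b X c0 beta.
Let delta := const_delta X alpha0 C1 b.

Lemma const_b_bounds : 0 < X -> 0 < c0 < 1 -> 0 < beta -> 0 < b <= 4^-1.
Proof.
move=> X0 /andP[c00 c01] b0; rewrite /b /const_b; apply/andP; split.
  by rewrite !mulr_gt0 ?expR_gt0 ?invr_gt0.
have e1 (r : R) : 0 <= r -> expR (- r) <= 1 by move=> r0; rewrite -expR0 ler_expR oppr_le0.
have h1 : expR (- beta * X) <= 1 by rewrite mulNr e1// mulr_ge0// ltW.
have h2 : expR (- (8 / 3)) <= 1 :> R by rewrite e1// divr_ge0.
have h3 := expR_ge0 (- beta * X); have h4 := expR_ge0 (- (8 / 3) : R).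
rewrite -[leRHS]mulr1 ler_pM// ?mulr_ge0 ?divr_ge0 ?(ltW c00)//.
rewrite -[leRHS]mulr1 ler_pM// ?mulr_ge0 ?divr_ge0 ?(ltW c00)//.
by rewrite ler_pdivrMr// mulVf// ltW.
Qed.

(** Positivity is the delicate point: the infimum in the definition is bounded
    below by (alpha0 / 2)(1 - alpha0) b^2. *)
Lemma const_delta_bounds : 0 < b -> 0 < X -> 0 < alpha0 < 1 -> 0 < C1 ->
  [/\ 0 < delta, delta <= 321^-1 & 10 * delta <= alpha0 * (1 - alpha0) * b ^+ 2].
Proof.
move=> b0 X0 /andP[a0 a1] C0; rewrite /delta /const_delta.
have N0 : 0 < 321 :> R by lra.
(* Of the constant 321 only the sign matters. *)
move: (321 : R) N0 => N N0.
set S := [set _ | _ in _].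
have min_l (x y : R) : Num.min x y <= x by rewrite ge_min lexx.
have min_r (x y : R) : Num.min x y <= y by rewrite ge_min lexx orbT.
have Slb : lbound S (alpha0 / 2 * (1 - alpha0) * b ^+ 2).
  move=> z [a ain <-]; move: ain; rewrite /= in_itv/= => /andP[ha ha'].
  rewrite ler_pM2r ?exprn_gt0// ler_pM//; lra.
have Sa : S (alpha0 * (1 - alpha0) * b ^+ 2).
  by exists alpha0 => //; rewrite /= in_itv/= lexx andbT; lra.
split.
- rewrite !lt_min; apply/and3P; split.
  + rewrite mulr_gt0 ?invr_gt0//; apply: (lt_le_trans (y := alpha0 / 2 * (1 - alpha0) * b ^+ 2)).
      by apply: mulr_gt0; [apply: mulr_gt0; [exact: divr_gt0|rewrite subr_gt0]|exact: exprn_gt0].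
    by apply: lb_le_inf => //; exists (alpha0 * (1 - alpha0) * b ^+ 2).
  + by rewrite invr_gt0 mulr_gt0// expR_gt0.
  + by rewrite divr_gt0 ?lt_min ?ltr01// mulr_gt0// powR_gt0.
- apply: (le_trans (y := (N * expR X)^-1)); first exact: le_trans (min_r _ _) (min_l _ _).
  rewrite lef_pV2 ?posrE ?mulr_gt0 ?expR_gt0//.
  by rewrite ler_peMr ?(ltW N0)// -[leLHS]expR0 ler_expR ltW.
- have h2 : inf S <= alpha0 * (1 - alpha0) * b ^+ 2.
    by apply: ge_inf => //; exists (alpha0 / 2 * (1 - alpha0) * b ^+ 2).
  apply: le_trans h2; rewrite mulrC -ler_pdivlMr// mulrC.
  exact: min_l.
Qed.

(** Since K >= 2 e^X, the claim amounts to (delta b)^r (1 + 2 m) <= 1 with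
    r = 1/alpha0 - 1.  As delta b <= 1/e the power is at most e^(-r), while
    1 + 2 m <= 1 + alpha0 (1 - alpha0) <= 1 + r <= e^r. *)
Lemma transport_amplitude (m : R) (A := (delta * b) `^ alpha0^-1 / const_K X alpha0 C1) :
  0 < X -> 0 < alpha0 < 1 -> 0 < b <= 4^-1 -> 0 < delta <= 321^-1 ->
  0 <= m -> 2 * m <= alpha0 * (1 - alpha0) ->
  0 < A /\ A * expR X * (1 + 2 * m) <= delta * b / 2.
Proof.
move=> X0 /andP[a0 a1] /andP[b0 b1] /andP[d0 d1] m0 hm.
have db0 : 0 < delta * b by rewrite mulr_gt0.
have K2 : 2 * expR X <= const_K X alpha0 C1.
  by rewrite /const_K mulrC ler_pM2l ?expR_gt0// le_max lexx.
have X1 := expR_gt0 X.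
have K0 : 0 < const_K X alpha0 C1 by apply: lt_le_trans K2; rewrite mulr_gt0.
have P0 : 0 < (delta * b) `^ alpha0^-1 by rewrite powR_gt0.
have A0 : 0 < A by rewrite divr_gt0.
split => //.
have AX : A * expR X <= (delta * b) `^ alpha0^-1 / 2.
  rewrite /A mulrAC ler_pdivrMr// -mulrA ler_pM2l//.
  by rewrite mulrC -ler_pdivrMr ?invr_gt0// invrK mulrC.
set r := alpha0^-1 - 1.
have r0 : 0 <= r by rewrite subr_ge0 invf_ge1// ltW.
have PE : (delta * b) `^ alpha0^-1 = delta * b * (delta * b) `^ r.
  by rewrite /r mulr_powRB1 ?ltW// invr_gt0.
have small : delta * b <= expR (- 1).
  (* delta b is at most 1/4, and 1/4 <= e^(-1) because e^(-1/2) >= 1/2 *)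
  have h : 2^-1 <= expR (- 2^-1) :> R by have := expR_ge1Dx (- 2^-1 : R); lra.
  have -> : (- 1 : R) = - 2^-1 + - 2^-1 by lra.
  rewrite expRD; nra.
have Pr : (delta * b) `^ r <= expR (- r).
  apply: (le_trans (y := expR (- 1) `^ r)).
    by apply: ge0_ler_powR => //; rewrite nnegrE ltW// expR_gt0.
  by rewrite /powR expR_eq0 expRK mulrN1.
have mr : 1 + 2 * m <= expR r.
  apply: le_trans (expR_ge1Dx r); rewrite lerD2l (le_trans hm)//.
  rewrite /r; have aV : alpha0 * alpha0^-1 = 1 by rewrite divff// gt_eqF.
  have : 0 < alpha0^-1 by rewrite invr_gt0.
  set i := alpha0^-1 in aV *; move=> i0.
  have -> : i - 1 = i * (1 - alpha0) by rewrite mulrBr mulr1 [i * _]mulrC aV.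
  rewrite ler_pM2r ?subr_gt0//; nra.
have Pr0 := powR_ge0 (delta * b) r.
have X2 : (delta * b) `^ r * (1 + 2 * m) <= 1.
  apply: (le_trans (y := (delta * b) `^ r * expR r)); first by rewrite ler_wpM2l.
  apply: (le_trans (y := expR (- r) * expR r)); first by rewrite ler_wpM2r// expR_ge0.
  by rewrite -expRD addNr expR0.
have m1 : 0 <= 1 + 2 * m by lra.
apply: (le_trans (ler_wpM2r m1 AX)); rewrite PE.
have -> : delta * b * (delta * b) `^ r / 2 * (1 + 2 * m) = delta * b / 2 * ((delta * b) `^ r * (1 + 2 * m)) by ring.
by rewrite ler_piMr// divr_ge0 ?ltW.
Qed.

End Constants.

(** * Properties of a solution *)

Section Solution.
Context {R : realType}.
Variables (X T : R) (w0 w1 l : R * R -> R) (w : R * R * R -> R).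
Hypothesis X0 : 0 < X.
Hypothesis T0 : 0 < T.
Hypothesis sol : oleinik_monotone_solution T X w0 w1 l w.

Local Notation M := (w_w_eta_eta X l w).
Local Notation wt := (w_tau X w).
Local Notation wx := (w_xi X w).

Let dirs : [/\ is_dir (dir_tau : R * R * R), is_dir (dir_xi : R * R * R)
  & is_dir (dir_eta : R * R * R)].
Proof. by split; [exact: Or31|exact: Or32|exact: Or33]. Qed.

Lemma ext_face_interior (v : R * R -> R) (f : R * R * R -> R) q :
  interior_dom X q -> ext_face v f q = f q.
Proof.
by move: q => [[s y] e] /interior_domP[_ _ /andP[_ e1]]; rewrite /ext_face /= lt_eqF.
Qed.

Lemma solution_deriv v q : is_dir v -> interior_dom X q ->
  deriv_on (dom X) v w q = 'D_v w q.
Proof.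
move=> dv Uq; have [_ /(_ v dv)[dw _]] := oleinik_C2 sol.
exact: deriv_on_interiorE (dw _ (sub_dom Uq)) Uq.
Qed.

Lemma w_w_eta_eta_interior q : interior_dom X q -> M q = w q * 'D_dir_eta ('D_dir_eta w) q.
Proof.
move=> Uq; have [_ _ de] := dirs; rewrite /w_w_eta_eta (ext_face_interior _ _ Uq).
by congr (_ * _); exact: (deriv_on2_interiorE (oleinik_C2 sol) de de Uq).
Qed.

Lemma crocco_interior q : interior_dom X q -> q.1.1 <= T ->
  - 'D_dir_tau w q - q.2 * 'D_dir_xi w q
     + w q ^+ 2 * 'D_dir_eta ('D_dir_eta w) q = 0.
Proof.
move=> Uq qT; have [dt dx de] := dirs.
have e1 := solution_deriv dt Uq; have e2 := solution_deriv dx Uq.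
have e3 := deriv_on2_interiorE (oleinik_C2 sol) de de Uq.
have : - deriv_on (dom X) dir_tau w q - q.2 * deriv_on (dom X) dir_xi w q
    + w q ^+ 2 * deriv_on (dom X) dir_eta (deriv_on (dom X) dir_eta w) q = 0.
  move: q Uq qT {e1 e2 e3} => [[s y] e] /interior_domP[s0 /andP[y0 yX] e01] /= sT.
  by apply: (crocco_eq (oleinik_crocco sol)); rewrite ?s0 ?y0 ?(ltW yX).
by rewrite e1 e2 e3.
Qed.

Lemma smooth_interior : smooth (interior_dom X) 3 w.
Proof.
apply: (class_C_smooth _ _ _ (oleinik_C3 sol)) => //.
  exact: open_interior_dom.
exact: sub_dom_interior.
Qed.

Lemma identity_algebra (f g m a b c e W : R) : f = a -> g = b -> m = W * c ->
  - a - e * b + W ^+ 2 * c = 0 -> (1 - e) * f + e * (g + f) - W * m = 0.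
Proof. by move=> -> -> -> h; lra. Qed.

(** In the interior this is the Crocco equation, rewritten with the factor w w_etaeta
    in place of w_etaeta; in this form both sides are continuous up to the
    boundary. *)
Lemma crocco_identity (s y e : R) : 0 <= s <= T -> 0 <= y <= X -> 0 <= e <= 1 ->
  (1 - e) * wt (s, y, e) + e * (wx (s, y, e) + wt (s, y, e)) = w (s, y, e) * M (s, y, e).
Proof.
move=> hs hy he.
pose G (q : R * R * R) := (1 - q.2) * wt q + q.2 * (wx q + wt q) - w q * M q.
have c2 : {within dom_closed X, continuous (fun q : R * R * R => q.2)}.
  by apply: continuous_subspaceT => q; exact: cvg_snd.
have Gc : {within dom_closed X, continuous G}.
  have ct := oleinik_w_tau_cont sol; have cx := oleinik_w_xi_cont sol.
  have cw := oleinik_w_cont sol; have cM := oleinik_w_w_eta_eta_cont sol.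
  move=> q; apply: cvgB; last by apply: cvgM; [exact: cw | exact: cM].
  apply: cvgD; apply: cvgM; [|exact: ct|exact: c2|apply: cvgD; [exact: cx|exact: ct]].
  by apply: cvgB; [exact: cvg_cst | exact: c2].
have GI q : interior_dom X q -> q.1.1 <= T -> G q = 0.
  move=> Uq qT; have [dt dx de] := dirs.
  have e1 : wt q = 'D_dir_tau w q.
    by rewrite /w_tau (ext_face_interior _ _ Uq); exact: solution_deriv.
  have e2 : wx q = 'D_dir_xi w q.
    by rewrite /w_xi (ext_face_interior _ _ Uq); exact: solution_deriv.
  have e3 := w_w_eta_eta_interior Uq; have e4 := crocco_interior Uq qT.
  exact: (identity_algebra e1 e2 e3 e4).
have half (r : R) : 0 < r -> 0 < r / 2 < r by move=> r0; apply/andP; split; lra.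
have seg (h : R) : 0 < h < 1 ->
  G (s + h * (T / 2 - s), y + h * (X / 2 - y), e + h * (2^-1 - e)) = 0.
  move=> h01.
  have /andP[s1 s2] : 0 < s + h * (T / 2 - s) < T.
    by apply: segment_in_open => //; exact: half.
  apply: GI; last exact: ltW.
  apply/interior_domP; split => //; apply: segment_in_open => //; first exact: half.
  by have := half 1 ltr01; rewrite mul1r.
have Dp : dom_closed X (s, y, e) by apply/dom_closedP; split=> //; case/andP: hs.
have Dc : dom_closed X (T / 2, X / 2, 2^-1).
  by apply/dom_closedP; split; [lra| |]; apply/andP; split; lra.
have Gle : G (s, y, e) <= 0.
  by apply: (le0_closure Gc Dp Dc) => h /seg ->.
have Gge : (- G) (s, y, e) <= 0.
  have GNc : {within dom_closed X, continuous (- G)} by move=> q; apply: cvgN; exact: Gc.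
  by apply: (le0_closure GNc Dp Dc) => h /seg hh; rewrite /GRing.opp/= hh oppr0.
have G0 : G (s, y, e) = 0.
  by apply/eqP; rewrite eq_le Gle -oppr_le0.
by apply/eqP; rewrite -subr_eq0; apply/eqP; exact: G0.
Qed.

(** For v = tau and v = xi the function is w_tau and w_xi.  Positivity of w at
    eta = 0 turns the condition w w_eta = 0 into w_eta = 0. *)
Lemma linearized_derivative v (T1 : R) : v = dir_tau \/ v = dir_xi -> T1 <= T ->
  (forall s y : R, 0 <= s <= T1 -> 0 <= y <= X -> 0 < w (s, y, 0)) ->
  {within dom_closed X, continuous (ext_face (fun _ => 0) (deriv_on (dom X) v w))} ->
  linearized X T1 w M (ext_face (fun _ => 0) (deriv_on (dom X) v w)).
Proof.
move=> hv T1T wpos fc; set f := ext_face _ _ in fc *.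
have dv : is_dir v by case: hv => ->; [exact: Or31|exact: Or32].
have [dt dx de] := dirs.
have sw := smooth_interior; have [_ /(_ v dv)[_ sv]] := sw.
have fE q : interior_dom X q -> 'D_v w q = f q.
  by move=> Uq; rewrite /f (ext_face_interior _ _ Uq) solution_deriv.
have nfE q : interior_dom X q -> {near q, 'D_v w =1 f}.
  by move=> Uq; apply: filterS (nbhs_interior_dom Uq) => p; exact: fE.
have [_ /= sv'] := sv.
have dfu u q : is_dir u -> interior_dom X q -> is_derive q u f ('D_u ('D_v w) q).
  move=> du Uq; apply: near_eq_is_derive (nfE q Uq) _.
  by have [dd _] := sv' u du; split => //; exact: dd.
split => //.
- move=> s y hs hy.
  have fb : right_slope (deriv_on (dom X) v w) s y 0.
    apply: (neumann_derivative (oleinik_C2 sol) _ hv hs hy) => s' y' /andP[s0 sT] hy'.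
    have hs' : 0 <= s' <= T1 by rewrite s0 ltW.
    have := crocco_eta0 (oleinik_crocco sol) (tau := s') (xi := y').
    move=> /(_ _ hy')/eqP; rewrite s0 (le_trans (ltW sT) T1T) => /(_ isT).
    by rewrite mulf_eq0 gt_eqF ?wpos//= => /eqP.
  have nE : \forall h \near (0:R)^'+,
      h^-1 * (deriv_on (dom X) v w (s, y, h) - deriv_on (dom X) v w (s, y, 0)) =
      h^-1 * (f (s, y, h) - f (s, y, 0)).
    apply: filterS (nbhs_right_lt ltr01) => h h1.
    by rewrite /f /ext_face /= !lt_eqF.
  rewrite /right_slope in fb *; exact: (cvg_trans (near_eq_cvg nE) fb).
exists ('D_dir_tau ('D_v w)), ('D_dir_xi ('D_v w)), ('D_dir_eta ('D_v w)),
   ('D_dir_eta ('D_dir_eta ('D_v w))).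
split.
  split=> q Uq _; try exact: dfu.
  have [_ [_ /(_ _ de)[dd _]]] := sv' _ de.
  by split => //; exact: dd.
move=> [[s y] e] Uq sT.
have := crocco_linearized sw crocco_interior hv Uq (lt_le_trans sT T1T).
have E1 := w_w_eta_eta_interior Uq; have E2 := fE _ Uq.
by move=> E; apply: (eq_trans E); congr (_ * _ * _).
Qed.

End Solution.

(** * The continuity argument *)

Section Bootstrap.
Context {R : realType}.
Variables (X c0 mu alpha0 C1 beta T : R).
Variables (w0 w1 l : R * R -> R) (w : R * R * R -> R) (T1 : R).
Hypothesis X0 : 0 < X.
Hypothesis T0 : 0 < T.
Hypothesis sol : oleinik_monotone_solution T X w0 w1 l w.
Hypothesis data : data_conditions T X c0 mu alpha0 C1 beta w0 w1 w.
Hypothesis T1T : 0 < T1 <= T.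
Let b := const_b X c0 beta.
Let delta := const_delta X alpha0 C1 b.
Hypothesis w_ge : forall tau xi eta : R,
  0 <= tau <= T1 -> 0 <= xi <= X -> 0 <= eta <= 1 -> b * (1 - eta) <= w (tau, xi, eta).

Local Notation M := (w_w_eta_eta X l w).
Local Notation f := (w_tau X w).
Local Notation g := (fun q => w_xi X w q + w_tau X w q).
Let A := (delta * b) `^ alpha0^-1 / const_K X alpha0 C1.
Let m := 3 * delta / b ^+ 2.

Let b_bounds : 0 < b <= 4^-1.
Proof. exact: const_b_bounds X0 (data_c0 data) (data_beta data). Qed.

Let delta_bounds :
  [/\ 0 < delta, delta <= 321^-1 & 10 * delta <= alpha0 * (1 - alpha0) * b ^+ 2].
Proof.
have /andP[b0 _] := b_bounds.
exact: const_delta_bounds b0 X0 (data_alpha0 data) (data_C1 data).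
Qed.

Let m_bounds : 0 <= 2 * m <= 3 / 5 * (alpha0 * (1 - alpha0)).
Proof.
have /andP[b0 _] := b_bounds; have [d0 _ d2] := delta_bounds.
have b20 : 0 < b ^+ 2 by rewrite exprn_gt0.
rewrite /m; apply/andP; split.
  by apply: mulr_ge0 => //; apply: divr_ge0; [lra | exact: ltW].
rewrite mulrA ler_pdivrMr//; lra.
Qed.

Let mb : m * b ^+ 2 = 3 * delta.
Proof. by have /andP[b0 _] := b_bounds; rewrite /m divfK// expf_neq0// gt_eqF. Qed.

Let amplitude : 0 < A /\ A * expR X * (1 + 2 * m) <= delta * b / 2.
Proof.
have [d0 d1 _] := delta_bounds; have /andP[m0 m1] := m_bounds.
have /andP[a0 a1] := data_alpha0 data.
have aa : 0 < alpha0 * (1 - alpha0) by rewrite mulr_gt0// subr_gt0.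
apply: (transport_amplitude X0 (data_alpha0 data) b_bounds).
- by rewrite d0 d1.
- lra.
- by apply: le_trans m1 _; lra.
Qed.

Let transport_barrier_le (s y e : R) : 0 <= s <= T1 -> 0 <= y <= X -> 0 <= e <= 1 ->
  transport_barrier A m (s, y, e) <= delta / 2 * w (s, y, e).
Proof.
move=> hs hy he; have bw := w_ge hs hy he; have [A0 Ab] := amplitude.
have [d0 _ _] := delta_bounds; have /andP[m0 _] := m_bounds.
case/andP: hy => y0 yX; case/andP: he => e0 e1.
have r0 : 0 <= 1 - e by rewrite subr_ge0.
have m0' : 0 <= m by lra.
rewrite /transport_barrier /=.
have -> : 1 - e + m * (1 - e ^+ 2) = (1 + m * (1 + e)) * (1 - e) by ring.
apply: (le_trans (y := A * expR X * (1 + 2 * m) * (1 - e))).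
  have k1 : 0 <= m * (1 + e) by rewrite mulr_ge0// addr_ge0.
  have k2 : 0 <= m * (1 - e) by rewrite mulr_ge0.
  rewrite mulrA ler_wpM2r//; apply: ler_pM; [|lra| |lra].
    by rewrite mulr_ge0 ?expR_ge0 ?ltW.
  by rewrite ler_pM2l// ler_expR.
apply: (le_trans (ler_wpM2r r0 Ab)).
have -> : delta * b / 2 * (1 - e) = delta / 2 * (b * (1 - e)) by ring.
by rewrite ler_wpM2l// divr_ge0// ltW.
Qed.

Let transport_barrier_ge (s y e : R) : 0 <= y -> 0 <= e <= 1 ->
  A * (1 - e) <= transport_barrier A m (s, y, e).
Proof.
move=> y0 /andP[e0 e1]; have [A0 _] := amplitude; have /andP[m0 _] := m_bounds.
rewrite /transport_barrier /= -mulrA ler_pM2l//.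
have E1 : 1 <= expR y by rewrite -expR0 ler_expR.
have h : 1 - e <= 1 - e + m * (1 - e ^+ 2).
  by rewrite lerDl mulr_ge0//; [lra | nra].
by rewrite -[leLHS]mul1r ler_pM// subr_ge0.
Qed.

Definition derivative_estimates (s y e : R) :=
  [/\ - C1 * (1 - e) `^ alpha0 <= g (s, y, e), g (s, y, e) <= delta / 2 * w (s, y, e),
      - C1 * (1 - e) `^ alpha0 <= f (s, y, e) &
      f (s, y, e) <= b * delta * (1 - e) `^ alpha0].

(** Insert the upper bounds in (1 - eta) f + eta g = w M: by b (1 - eta) <= w the
    first term is at most delta w, the second one is at most (delta / 2) w, and
    w > 0 can be cancelled. *)
Let M_le_of_estimates (s y e : R) : 0 <= s <= T1 -> 0 <= y <= X -> 0 <= e < 1 ->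
  derivative_estimates s y e -> M (s, y, e) <= 3 / 2 * delta.
Proof.
move=> hs hy /andP[e0 e1] [_ gw _ fb].
have he : 0 <= e <= 1 by rewrite e0 ltW.
have /andP[b0 _] := b_bounds; have [d0 _ _] := delta_bounds.
have /andP[a0 a1] := data_alpha0 data; have /andP[T10 T1T'] := T1T.
have bw := w_ge hs hy he.
have r0 : 0 < 1 - e by rewrite subr_gt0.
have W0 : 0 < w (s, y, e) by apply: lt_le_trans bw; rewrite mulr_gt0.
have hs' : 0 <= s <= T by case/andP: hs => -> h; rewrite (le_trans h).
have Id := crocco_identity X0 T0 sol hs' hy he.
have P1 : (1 - e) `^ alpha0 <= 1.
  have := ge0_ler_powR (ltW a0) (x := 1 - e) (y := 1); rewrite powR1; apply.
  - by rewrite nnegrE ltW.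
  - by rewrite nnegrE.
  - by rewrite gerBl.
have P0 := powR_ge0 (1 - e) alpha0.
rewrite -(ler_pM2l W0) -Id.
have h1 : (1 - e) * f (s, y, e) <= delta * w (s, y, e).
  apply: (le_trans (ler_wpM2l (ltW r0) fb)).
  apply: (le_trans (y := (1 - e) * (b * delta * 1))).
    by rewrite ler_wpM2l ?(ltW r0)// ler_wpM2l// mulr_ge0 ?ltW.
  have -> : (1 - e) * (b * delta * 1) = delta * (b * (1 - e)) by ring.
  by rewrite ler_wpM2l// ltW.
have h2 : e * g (s, y, e) <= delta / 2 * w (s, y, e).
  apply: (le_trans (ler_wpM2l e0 gw)); apply: ler_piMl; last exact: ltW.
  by rewrite mulr_ge0 ?divr_ge0 ?ltW.
lra.
Qed.

(** The identity for w M says nothing at eta = 1, where w = 0; the bound is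
    obtained there as a limit. *)
Let M_le_eta1 (s y : R) : 0 <= s -> 0 <= y <= X ->
  (forall e : R, 0 <= e < 1 -> M (s, y, e) <= 3 / 2 * delta) ->
  M (s, y, 1) <= 3 / 2 * delta.
Proof.
move=> s0 hy HM; rewrite -subr_le0.
have Gc : {within dom_closed X, continuous (fun q => M q - 3 / 2 * delta)}.
  by move=> q; apply: cvgB; [exact: (oleinik_w_w_eta_eta_cont sol) | exact: cvg_cst].
apply: (le0_closure (s' := s) (y' := y) (e' := 0) Gc).
- by apply/dom_closedP; split=> //; rewrite ler01 lexx.
- by apply/dom_closedP; split=> //; rewrite ler01 lexx.
move=> h /andP[h0 h1]; rewrite !subrr !mulr0 !addr0 sub0r mulrN1 subr_le0.
by apply: HM; apply/andP; split; lra.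
Qed.

Let bounds_tau0 (y e : R) : 0 <= y <= X -> 0 <= e <= 1 -> derivative_estimates 0 y e.
Proof.
move=> hy he; have [/andP[g1 g2] /andP[f1 f2]] := data_tau0 data hy he.
have T10 : 0 <= (0 : R) <= T1 by rewrite lexx; case/andP: T1T => /ltW.
split => //; apply: (le_trans g2); apply: le_trans (transport_barrier_le T10 hy he).
by apply: transport_barrier_ge => //; case/andP: hy.
Qed.

(** On the faces tau = 0, xi = 0 and eta = 1 the estimates follow from the data conditions;
    inside, each of the four is a comparison with a supersolution. *)
Let bounds_step (t : R) : 0 < t <= T1 ->
  (forall s y e : R, 0 <= s < t -> 0 <= y <= X -> 0 <= e <= 1 -> M (s, y, e) <= 2 * delta) ->
  forall s y e : R, 0 <= s <= t -> 0 <= y <= X -> 0 <= e <= 1 -> derivative_estimates s y e.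
Proof.
move=> /andP[t0 tT1] HM s y e hs hy he.
have /andP[T10 T1T'] := T1T.
have /andP[b0 b1] := b_bounds; have [d0 d1 d2] := delta_bounds.
have /andP[m0 m1] := m_bounds; have [A0 _] := amplitude.
have a01 := data_alpha0 data; have /andP[a0 a1] := a01.
have tT : t <= T by exact: le_trans T1T'.
have wpos (r z : R) : 0 <= r <= t -> 0 <= z <= X -> 0 < w (r, z, 0).
  move=> /andP[s0 st] hy'; have : b * (1 - 0) <= w (r, z, 0).
    by apply: w_ge => //; [rewrite s0 (le_trans st) | rewrite lexx ler01].
  by apply: lt_le_trans; rewrite subr0 mulr1.
have lf : linearized X t w M f.
  by apply: (linearized_derivative sol _ tT wpos (oleinik_w_tau_cont sol)); left.
have lx : linearized X t w M (w_xi X w).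
  by apply: (linearized_derivative sol _ tT wpos (oleinik_w_xi_cont sol)); right.
have lg := linearizedD lx lf.
have Mint q : interior_dom X q -> q.1.1 < t -> M q <= 2 * delta.
  move: q => [[s' y'] e'] /interior_domP[s0 /andP[? ?] /andP[? ?]] st.
  by apply: HM; rewrite ?(ltW s0)//; apply/andP; rewrite !ltW.
have wM q : interior_dom X q -> q.1.1 < t -> b * (1 - q.2) <= w q /\ 2 * M q <= 4 * delta.
  move=> Uq st; split; last by have := Mint q Uq st; lra.
  move: q Uq st => [[s' y'] e'] /interior_domP[s0 /andP[? ?] /andP[? ?]] /= st.
  by apply: w_ge; apply/andP; split; try exact: ltW; exact: ltW (lt_le_trans st tT1).
have pow C : 0 < C -> strict_supersolution X t w M (power_barrier C alpha0).
  move=> C0; apply: (power_supersolution C0 a01 b0 _ wM).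
  by apply: lt_le_trans d2; rewrite ltr_pM2r// ltr_nat.
have tr : strict_supersolution X t w M (transport_barrier A m).
  apply: (transport_supersolution A0 b0 _ mb _ wM); first by rewrite d0.
  rewrite m0 (le_trans m1)//; have := sqr_ge0 (2 * alpha0 - 1); lra.
have bd (r z u : R) : 0 <= r <= t -> 0 <= z <= X -> 0 <= u <= 1 ->
   [\/ r = 0, z = 0 | u = 1] ->
   [/\ - C1 * (1 - u) `^ alpha0 <= g (r, z, u), g (r, z, u) <= A * (1 - u),
      - C1 * (1 - u) `^ alpha0 <= f (r, z, u) &
      f (r, z, u) <= b * delta * (1 - u) `^ alpha0].
  move=> /andP[s0 st] hy' he' [->|->|->].
  - by have [/andP[? ?] /andP[? ?]] := data_tau0 data hy' he'; split.
  - have hs' : 0 <= r <= T by rewrite s0 (le_trans st).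
    by have [/andP[? ?] /andP[? ?]] := data_xi0 data hs' he'; split.
  - rewrite /w_xi /w_tau /ext_face /= eqxx subrr powR0 ?gt_eqF// !mulr0 addr0.
    by split.
split.
- rewrite mulNr lerNl -mulN1r.
  apply: (linearized_le t0 X0 (linearized_scale (-1) lg) (pow C1 (data_C1 data)) Mint) => //.
  move=> s' y' e' hs' hy' he' hb; have [h _ _ _] := bd s' y' e' hs' hy' he' hb.
  by rewrite mulN1r lerNl -mulNr.
- apply: le_trans (transport_barrier_le _ hy he); last first.
    by case/andP: hs => ->/= /le_trans; apply.
  apply: (linearized_le t0 X0 lg tr Mint) => //.
  move=> s' y' e' hs' hy' he' hb; have [_ h _ _] := bd s' y' e' hs' hy' he' hb.
  by apply: (le_trans h); apply: transport_barrier_ge => //; case/andP: hy'.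
- rewrite mulNr lerNl -mulN1r.
  apply: (linearized_le t0 X0 (linearized_scale (-1) lf) (pow C1 (data_C1 data)) Mint) => //.
  move=> s' y' e' hs' hy' he' hb; have [_ _ h _] := bd s' y' e' hs' hy' he' hb.
  by rewrite mulN1r lerNl -mulNr.
- have bd0 : 0 < b * delta by rewrite mulr_gt0.
  apply: (linearized_le t0 X0 lf (pow _ bd0) Mint) => //.
  by move=> s' y' e' hs' hy' he' hb; have [_ _ _ h] := bd s' y' e' hs' hy' he' hb.
Qed.

Let closed_superlevel : closed [set q | box T1 X q /\ 2 * delta <= M q].
Proof.
move=> p clp.
have cb : closed (box T1 X) by apply: compact_closed; [exact: norm_hausdorff | exact: compact_box].
have bp : box T1 X p by apply: cb; apply: closure_subset clp => q [].
have sub : box T1 X `<=` dom_closed X.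
  by move=> [[s y] e] /boxP[/andP[? ?] ? ?]; apply/dom_closedP.
split => //; rewrite leNgt; apply/negP => Mp.
have /subspace_continuousP/(_ p (sub _ bp)) Mc := oleinik_w_w_eta_eta_cont sol.
have nb : \forall q \near p, dom_closed X q -> M q < 2 * delta.
  exact: (cvgr_lt _ Mc _ Mp).
have [q [[bq Mq] /(_ (sub _ bq))]] := clp _ nb.
by rewrite ltNge Mq.
Qed.

(** Among the points where M >= 2 delta pick one of least tau.  Before that time
    M < 2 delta, so the estimates hold up to and including it (at tau = 0 they
    follow from the data), and they give M <= 3 delta / 2 at that point. *)
Lemma w_w_eta_eta_lt (s y e : R) : 0 <= s <= T1 -> 0 <= y <= X -> 0 <= e <= 1 ->
  M (s, y, e) < 2 * delta.
Proof.
have [d0 _ _] := delta_bounds; have /andP[T10 T1T'] := T1T.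
have M_lt_of_estimates s' : 0 <= s' <= T1 ->
   (forall y e : R, 0 <= y <= X -> 0 <= e <= 1 -> derivative_estimates s' y e) ->
   forall y e : R, 0 <= y <= X -> 0 <= e <= 1 -> M (s', y, e) < 2 * delta.
  move=> hs' HB y' e' hy' he'.
  apply: (le_lt_trans (y := 3 / 2 * delta)); last by rewrite ltr_pM2r//; lra.
  have H e1 : 0 <= e1 < 1 -> M (s', y', e1) <= 3 / 2 * delta.
    move=> h; apply: M_le_of_estimates => //; apply: HB => //.
    by case/andP: h => -> /ltW.
  case/andP: he' => e0; rewrite le_eqVlt => /predU1P[->|e1].
    by apply: M_le_eta1 => //; case/andP: hs'.
  by apply: H; rewrite e0.
move=> hs hy he; rewrite ltNge; apply/negP => Mge.
pose F := [set q | box T1 X q /\ 2 * delta <= M q].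
have F0 : F !=set0 by exists (s, y, e); split => //; apply/boxP.
have Fc : compact F.
  by apply: (subclosed_compact closed_superlevel (@compact_box _ T1 X)) => q [].
have tc : {within F, continuous (fun q : R * R * R => q.1.1)}.
  apply: continuous_subspaceT => q.
  exact: (@continuous_comp _ _ _ fst fst q (@cvg_fst _ _ _ _ _) (@cvg_fst _ _ _ _ _)).
have [[[s1 y1] e1] /set_mem[/boxP[hs1 hy1 he1] Mge1] Fmin] := compact_EVT_min F0 Fc tc.
suff HB (y2 e2 : R) : 0 <= y2 <= X -> 0 <= e2 <= 1 -> derivative_estimates s1 y2 e2.
  by have := M_lt_of_estimates s1 hs1 HB y1 e1 hy1 he1; rewrite ltNge Mge1.
move=> hy2 he2; case/andP: hs1 => s10 s11.
have [->|s1n] := eqVneq s1 0; first exact: bounds_tau0.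
have s1p : 0 < s1 by rewrite lt_neqAle eq_sym s1n.
apply: (@bounds_step s1) => //; rewrite ?s1p ?lexx ?s10//.
move=> s3 y3 e3 /andP[s30 s31] hy3 he3; rewrite leNgt; apply/negP => M3.
have : F (s3, y3, e3).
  by split; [apply/boxP; split => //; rewrite s30 (le_trans (ltW s31)) | exact: ltW].
by move=> /mem_set/Fmin /=; rewrite leNgt s31.
Qed.

Lemma apriori_estimates (s y e : R) : 0 <= s <= T1 -> 0 <= y <= X -> 0 <= e <= 1 ->
  M (s, y, e) <= 2 * delta /\ derivative_estimates s y e.
Proof.
move=> hs hy he; split; first exact/ltW/w_w_eta_eta_lt.
apply: (@bounds_step T1) => //; first by rewrite lexx; case/andP: T1T => ->.
move=> s' y' e' /andP[s0 s1] hy' he'; apply/ltW/w_w_eta_eta_lt => //.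
by rewrite s0 ltW.
Qed.

End Bootstrap.

Theorem proposition1p3 (R : realType) (X c0 mu alpha0 C1 beta T : R)
    (w0 w1 l : R * R -> R) (w : R * R * R -> R) (T1 : R)
    (b := const_b X c0 beta) (delta := const_delta X alpha0 C1 b) :
  0 < X -> 0 < T ->
  oleinik_monotone_solution T X w0 w1 l w ->
  data_conditions T X c0 mu alpha0 C1 beta w0 w1 w ->
  0 < T1 <= T ->
  (forall tau xi eta : R, 0 <= tau <= T1 -> 0 <= xi <= X -> 0 <= eta <= 1 ->
    b * (1 - eta) <= w (tau, xi, eta)) ->
  forall tau xi eta : R, 0 <= tau <= T1 -> 0 <= xi <= X -> 0 <= eta <= 1 ->
    [/\ w_w_eta_eta X l w (tau, xi, eta) <= 2 * delta,
        - C1 * (1 - eta) `^ alpha0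
          <= w_xi X w (tau, xi, eta) + w_tau X w (tau, xi, eta)
          <= delta / 2 * w (tau, xi, eta)
      & - C1 * (1 - eta) `^ alpha0 <= w_tau X w (tau, xi, eta)
          <= b * delta * (1 - eta) `^ alpha0].
Proof.
move=> X0 T0 sol data T1T w_ge tau xi eta htau hxi heta.
have [HM [g1 g2 f1 f2]] :=
  apriori_estimates X0 T0 sol data T1T w_ge htau hxi heta.
by split => //; apply/andP.
Qed.
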